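(* Let $\mathcal{C}$ be a full trio. The following statements are equivalent: (i) Configuration reachability is decidable for asynchronous programs over $\mathcal{C}$. (ii) Fair termination is decidable for asynchronous programs over $\mathcal{C}$. (iii) Fair starvation is decidable for asynchronous programs over $\mathcal{C}$. Moreover, if decidability holds, then the $Z$-intersection problem is decidable for $\mathcal{C}$.
   Context: Language classes. A language class is a collection of languages over finite alphabets together with some finite representation of its languages. A full trio is a language class closed under intersection with regular languages, homomorphic images, and inverse homomorphic images. All full trios are assumed to be effective: given (a representation of) a language $L$ from $\mathcal{C}$, a regular language $R$ and a homomorphism $h$, one can compute representations in $\mathcal{C}$ of $L\cap R$, $h(L)$ and $h^{-1}(L)$. Decidability for $\mathcal C$ means that the input languages are given by their representations. Multisets. $\mathbb{M}[\Sigma]$ is the set of multisets $\mathbf{m}\colon\Sigma\to\mathbb{N}$; $\oplus$ is pointwise addition; $[\![\sigma]\!]$ is the multiset containing $\sigma$ exactly once. For $w\in\Sigma^*$, $\mathsf{Parikh}(w)\in\mathbb{M}[\Sigma]$ maps each letter to its number of occurrences in $w$. Asynchronous programs. An asynchronous program over $\mathcal{C}$ is a tuple $\mathfrak{P}=(D,\Sigma,(L_c)_{c\in\mathfrak{C}},d_0,\mathbf{m}_0)$, where $D$ is a finite set of global states, $\Sigma$ is a finite alphabet of handler names, $\mathfrak{C}=D\times\Sigma\times D$ is the set of contexts, each $L_c\subseteq\Sigma^*$ is a language from $\mathcal{C}$, $d_0\in D$ is the initial state, and $\mathbf{m}_0\in\mathbb{M}[\Sigma]$. Configurations are pairs $c=(d,\mathbf{m})\in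 D\times\mathbb{M}[\Sigma]$; we write $c.\mathbf{m}$ for the multiset of $c$; the initial configuration is $(d_0,\mathbf{m}_0)$. Transitions: $(d,\mathbf{m}\oplus[\![\sigma]\!])\xrightarrow{\sigma}(d',\mathbf{m}\oplus\mathbf{m}')$ iff there is $w\in L_{(d,\sigma,d')}$ with $\mathsf{Parikh}(w)=\mathbf{m}'$. A run is a finite or infinite sequence of transitions starting in the initial configuration; a configuration is reachable if it occurs on some run. An infinite run $c_0\xrightarrow{\sigma_0}c_1\xrightarrow{\sigma_1}\cdots$ is fair if for all $i\ge 0$ and every $\sigma\in\Sigma$ with $c_i.\mathbf{m}(\sigma)\ge 1$ there is $j\ge i$ such that the $j$-th step is $c_j\xrightarrow{\sigma}c_{j+1}$ (i.e. $\sigma_j=\sigma$). An infinite fair run starves a handler $\sigma$ if there is $J\ge 0$ such that for each $j\ge J$: $c_j.\mathbf{m}(\sigma)\ge 1$, and whenever the $j$-th step is $c_j\xrightarrow{\sigma}c_{j+1}$, then $c_j.\mathbf{m}(\sigma)\ge 2$. Problems. Configuration reachability: given $\mathfrak{P}$ and a configuration $c$, is $c$ reachable in $\mathfrak{P}$? Fair termination: given $\mathfrak{P}$, decide whether $\mathfrak{P}$ has no fair infinite run (equivalently, for decidability, whether it has some fair infinite run). Fair starvation: given $\mathfrak{P}$, does $\mathfrak{P}$ have some infinite fair run that starves some handler? $Z$-intersection for $\mathcal{C}$: let $Z=\{w\in\{a,b\}^*\mid |w|_a=|w|_b\}$, where $|w|_x$ is the number of occurrences of $x$ in $w$; given a language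 $K\subseteq\{a,b\}^*$ from $\mathcal{C}$, is $K\cap Z\neq\emptyset$? *)

(* Defs.v *)
From Stdlib Require Cantor.
From mathcomp Require Import all_boot.

Set Implicit Arguments.
Unset Strict Implicit.
Unset Printing Implicit Defensive.

(* Decidability below means decidability by a partial recursive function on    *)
(* encoded inputs.  Mere existence of a Rocq function to bool would not do:    *)
(* every predicate has one as soon as classical choice is assumed.             *)

Definition npair (a b : nat) : nat := Cantor.to_nat (a, b).
Definition nfst (n : nat) : nat := (Cantor.of_nat n).1.
Definition nsnd (n : nat) : nat := (Cantor.of_nat n).2.

(* Programs for the unary partial recursive functions. *)
Inductive code : Type :=
| CZero | CSucc | CFst | CSnd
| CPair of code & code
| CComp of code & code
| CPrec of code & code
| CMin of code.

Inductive prec_graph (f g : nat -> nat -> Prop) (a : nat) : nat -> nat -> Prop :=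
| PrecO v : f a v -> prec_graph f g a 0 v
| PrecS n u v : prec_graph f g a n u -> g (npair a (npair n u)) v ->
    prec_graph f g a n.+1 v.

(* [eval c x y]: the program c halts on input x with output y.                 *)
Fixpoint eval (c : code) (x y : nat) : Prop :=
  match c with
  | CZero => y = 0
  | CSucc => y = x.+1
  | CFst => y = nfst x
  | CSnd => y = nsnd x
  | CPair f g => exists a b, [/\ eval f x a, eval g x b & y = npair a b]
  | CComp f g => exists2 a, eval g x a & eval f a y
  | CPrec f g => prec_graph (eval f) (eval g) (nfst x) (nsnd x) y
  | CMin f => eval f (npair x y) 0 /\
      forall i, i < y -> exists v, eval f (npair x i) v.+1
  end.

Definition enc_seq (T : Type) (enc : T -> nat) (s : seq T) : nat :=
  foldr (fun x n => (npair (enc x) n).+1) 0 s.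

(* A function on a finite index range is encoded by its table of values. *)
Definition enc_fun (k : nat) (T : Type) (enc : T -> nat) (f : 'I_k -> T) : nat :=
  enc_seq (fun i => enc (f i)) (enum 'I_k).

Definition enc_word (k : nat) (w : seq 'I_k) : nat := enc_seq (@nat_of_ord k) w.

(* Inputs outside dom are not valid instances; nothing is required on them. *)
Definition rec_decidable (X : Type) (enc : X -> nat) (dom : X -> Prop)
    (Q : X -> Prop) : Prop :=
  exists c : code, forall x : X, dom x ->
    exists2 b : bool, eval c (enc x) b & (b <-> Q x).

(* Finite alphabets are the types 'I_k; a representation is a natural number.  *)
(* [is_rep C k r] says that r represents a language over 'I_k, and then        *)
(* [lang C k r] is that language (it is junk otherwise).                       *)
Record lang_class : Type := LangClass {
  is_rep : nat -> nat -> Prop;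
  lang : forall k : nat, nat -> seq 'I_k -> Prop
}.

(* Nondeterministic finite automata over 'I_k: states are natural numbers, of  *)
(* which only finitely many occur in the three lists.                          *)
Record nfa (k : nat) : Type := Nfa {
  nfa_init : seq nat;
  nfa_final : seq nat;
  nfa_trans : seq (nat * 'I_k * nat)
}.

Fixpoint nfa_accept_from (k : nat) (A : nfa k) (q : nat) (w : seq 'I_k) : Prop :=
  match w with
  | [::] => q \in nfa_final A
  | x :: w' => exists2 q', (q, x, q') \in nfa_trans A & nfa_accept_from A q' w'
  end.

Definition nfa_lang (k : nat) (A : nfa k) (w : seq 'I_k) : Prop :=
  exists2 q, q \in nfa_init A & nfa_accept_from A q w.

Definition enc_nfa (k : nat) (A : nfa k) : nat :=
  npair (enc_seq id (nfa_init A))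
    (npair (enc_seq id (nfa_final A))
      (enc_seq (fun t : nat * 'I_k * nat => npair t.1.1 (npair t.1.2 t.2))
        (nfa_trans A))).

(* The homomorphism of free monoids determined by the images of the letters. *)
Definition hom (k m : nat) (h : 'I_k -> seq 'I_m) (w : seq 'I_k) : seq 'I_m :=
  flatten (map h w).

Definition enc_hom (k m : nat) (h : 'I_k -> seq 'I_m) : nat :=
  enc_fun (@enc_word m) h.

Definition closed_inter_regular (C : lang_class) : Prop :=
  exists c : code, forall (k r : nat) (A : nfa k), is_rep C k r ->
    exists r', [/\ eval c (npair k (npair r (enc_nfa A))) r', is_rep C k r' &
      forall w : seq 'I_k, lang C r' w <-> lang C r w /\ nfa_lang A w].

Definition closed_hom_image (C : lang_class) : Prop :=
  exists c : code, forall (k m r : nat) (h : 'I_k -> seq 'I_m), is_rep C k r ->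
    exists r', [/\ eval c (npair k (npair m (npair r (enc_hom h)))) r',
      is_rep C m r' &
      forall w : seq 'I_m,
        lang C r' w <-> exists2 u : seq 'I_k, lang C r u & w = hom h u].

Definition closed_hom_preimage (C : lang_class) : Prop :=
  exists c : code, forall (k m r : nat) (h : 'I_k -> seq 'I_m), is_rep C m r ->
    exists r', [/\ eval c (npair k (npair m (npair r (enc_hom h)))) r',
      is_rep C k r' &
      forall u : seq 'I_k, lang C r' u <-> lang C r (hom h u)].

(* Effective full trios. *)
Definition full_trio (C : lang_class) : Prop :=
  [/\ closed_inter_regular C, closed_hom_image C & closed_hom_preimage C].

Definition multiset (k : nat) : Type := {ffun 'I_k -> nat}.

Definition mplus (k : nat) (m m' : multiset k) : multiset k :=
  [ffun x => m x + m' x].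

Definition msingle (k : nat) (s : 'I_k) : multiset k :=
  [ffun x => nat_of_bool (x == s)].

Definition parikh (k : nat) (w : seq 'I_k) : multiset k :=
  [ffun x => count_mem x w].

(* Global states are 'I_states and handler names 'I_handlers; each context     *)
(* (d, s, d') carries the representation of its language.                      *)
Record async_prog : Type := AsyncProg {
  states : nat;
  handlers : nat;
  ctx_rep : 'I_states -> 'I_handlers -> 'I_states -> nat;
  state0 : 'I_states;
  mset0 : multiset handlers
}.
Arguments ctx_rep : clear implicits.

Definition prog_over (C : lang_class) (P : async_prog) : Prop :=
  forall d s d', is_rep C (handlers P) (ctx_rep P d s d').

Definition enc_prog (P : async_prog) : nat :=
  npair (states P) (npair (handlers P)
    (npair
      (enc_fun (enc_fun (enc_fun (fun r : nat => r))) (ctx_rep P))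
      (npair (state0 P) (enc_fun (fun n : nat => n) (mset0 P))))).

Definition config (P : async_prog) : Type :=
  ('I_(states P) * multiset (handlers P))%type.

Definition config0 (P : async_prog) : config P := (state0 P, mset0 P).

Definition enc_config (P : async_prog) (c : config P) : nat :=
  npair c.1 (enc_fun (fun n : nat => n) c.2).

Definition step (C : lang_class) (P : async_prog) (c : config P)
    (s : 'I_(handlers P)) (c' : config P) : Prop :=
  exists (m : multiset (handlers P)) (w : seq 'I_(handlers P)),
    [/\ c.2 = mplus m (msingle s),
        lang C (ctx_rep P c.1 s c'.1) w &
        c'.2 = mplus m (parikh w)].

(* A finite sequence of transitions, listed as (handler, next configuration). *)
Fixpoint steps (C : lang_class) (P : async_prog) (c : config P)
    (r : seq ('I_(handlers P) * config P)) : Prop :=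
  match r with
  | [::] => True
  | sc :: r' => step C c sc.1 sc.2 /\ steps C sc.2 r'
  end.

Definition finite_run (C : lang_class) (P : async_prog)
    (r : seq ('I_(handlers P) * config P)) : Prop :=
  steps C (config0 P) r.

Definition infinite_run (C : lang_class) (P : async_prog)
    (c : nat -> config P) (s : nat -> 'I_(handlers P)) : Prop :=
  c 0 = config0 P /\ forall i, step C (c i) (s i) (c i.+1).

Definition reachable (C : lang_class) (P : async_prog) (x : config P) : Prop :=
  (exists2 r, finite_run C r & x \in config0 P :: map snd r) \/
  (exists c s, infinite_run C c s /\ exists i, c i = x).

Definition fair (P : async_prog)
    (c : nat -> config P) (s : nat -> 'I_(handlers P)) : Prop :=
  forall (i : nat) (x : 'I_(handlers P)), 1 <= (c i).2 x ->
    exists2 j, i <= j & s j = x.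

Definition starves (P : async_prog)
    (c : nat -> config P) (s : nat -> 'I_(handlers P)) (x : 'I_(handlers P)) :
    Prop :=
  exists J, forall j, J <= j ->
    1 <= (c j).2 x /\ (s j = x -> 2 <= (c j).2 x).

Definition config_reachability_decidable (C : lang_class) : Prop :=
  rec_decidable
    (fun i : {P : async_prog & config P} =>
       npair (enc_prog (projT1 i)) (enc_config (projT2 i)))
    (fun i => prog_over C (projT1 i))
    (fun i => reachable C (projT2 i)).

Definition fair_termination_decidable (C : lang_class) : Prop :=
  rec_decidable enc_prog (prog_over C)
    (fun P => ~ exists (c : nat -> config P) (s : nat -> 'I_(handlers P)),
                  infinite_run C c s /\ fair c s).

Definition fair_starvation_decidable (C : lang_class) : Prop :=
  rec_decidable enc_prog (prog_over C)
    (fun P => exists (c : nat -> config P) (s : nat -> 'I_(handlers P)),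
                [/\ infinite_run C c s, fair c s & exists x, starves c s x]).

(* The alphabet {a, b} is 'I_2, with a = ord0 and b = ord_max. *)
Definition Z_lang (w : seq 'I_2) : Prop :=
  count_mem (ord0 : 'I_2) w = count_mem (ord_max : 'I_2) w.

Definition Z_intersection_decidable (C : lang_class) : Prop :=
  rec_decidable (fun r : nat => r) (is_rep C 2)
    (fun r => exists2 w : seq 'I_2, lang C r w & Z_lang w).

(* Main.v *)
(** In an infinite fair run the handlers that are executed only finitely often
    are eventually never pending.  By Dickson's lemma the run passes twice
    through the same state with growing multisets, and executes between the two
    passages every handler that is ever pending afterwards; repeating this loop
    gives back a fair run.  So a fair run is the same as a finite lasso.  A
    starving run is a lasso that leaves one instance of the starved handler
    aside.

    A lasso is detected by configuration reachability: simulate the program up to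
    the start of the loop, turn each pending task into a task for the simulation
    of the loop and a copy that remembers the multiset at its start, simulate the
    loop, and finally cancel the copies against the tasks pending at the end;
    surplus tasks can be discarded only if their handler was executed in the loop.
    The empty multiset is reachable in the last state iff there is a lasso.

    Conversely (d, m) is reachable iff one can simulate the program up to d,
    cancel the pending tasks against a copy of m given initially, and then
    execute for ever a control handler with two pending instances: fairness
    forces the cancellation to be exact, and the second instance of the control
    handler is starved.  The balanced words of a language K are treated
    alike: a first task posts a word of K, whose letters a and b are then
    cancelled.

    All languages occurring in these programs are homomorphic images of the given
    ones, of a fixed one-word language or of the empty language, which a full
    trio contains as soon as it contains a nonempty language (if all its languages
    are empty, everything is trivially decidable).  The states and handlers of a
    constructed program are numbered by Cantor codes; numbers that code nothing
    get empty languages. *)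

Require Import Defs.
From Stdlib Require Cantor.
From Stdlib Require Import Classical IndefiniteDescription.
From HB Require Import structures.
From mathcomp Require Import all_boot zify.

Set Implicit Arguments.
Unset Strict Implicit.
Unset Printing Implicit Defensive.

(** * Partial recursive programs *)

Lemma nfst_npair a b : nfst (npair a b) = a.
Proof. by rewrite /nfst /npair Cantor.cancel_of_to. Qed.

Lemma nsnd_npair a b : nsnd (npair a b) = b.
Proof. by rewrite /nsnd /npair Cantor.cancel_of_to. Qed.

Lemma npair_nfst_nsnd x : npair (nfst x) (nsnd x) = x.
Proof.
by rewrite /npair /nfst /nsnd -[RHS]Cantor.cancel_to_of; case: (Cantor.of_nat x).
Qed.

Definition npairK := (nfst_npair, nsnd_npair).

Lemma npair_inj a b a' b' : npair a b = npair a' b' -> a = a' /\ b = b'.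
Proof.
move=> e; split.
  by rewrite -(nfst_npair a b) e nfst_npair.
by rewrite -(nsnd_npair a b) e nsnd_npair.
Qed.

Lemma npair_eq a b a' b' : (npair a b == npair a' b') = (a == a') && (b == b').
Proof.
apply/eqP/andP => [/npair_inj [-> ->] //|[/eqP -> /eqP -> //]].
Qed.

(** By the closed form of the Cantor pairing, a sum plus a triangular number. Monotonicity gives the
    bounds on the codes of states and handlers. *)
Lemma leq_npair a b a' b' : a <= a' -> b <= b' -> npair a b <= npair a' b'.
Proof.
move=> ha hb; rewrite /npair.
have := Cantor.to_nat_spec a b; have := Cantor.to_nat_spec a' b'.
have : (b + a) * (b + a).+1 <= (b' + a') * (b' + a').+1 by apply: leq_mul; lia.
by rewrite -?multE -?plusE; lia.
Qed.

Lemma leq_npairl a b : a <= npair a b.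
Proof. by have := Cantor.to_nat_non_decreasing a b; rewrite /npair; lia. Qed.

Lemma leq_npairr a b : b <= npair a b.
Proof. by have := Cantor.to_nat_non_decreasing a b; rewrite /npair; lia. Qed.

Global Opaque npair nfst nsnd.

Definition computable (f : nat -> nat) : Prop :=
  exists c, forall x, eval c x (f x).

Lemma computable_id : computable (fun x => x).
Proof.
exists (CPair CFst CSnd) => x; exists (nfst x), (nsnd x).
by rewrite npair_nfst_nsnd.
Qed.

Lemma computable_comp f g :
  computable f -> computable g -> computable (fun x => f (g x)).
Proof. by move=> [c hc] [d hd]; exists (CComp c d) => x; exists (g x). Qed.

Lemma computable_succ f : computable f -> computable (fun x => (f x).+1).
Proof. by apply: computable_comp; exists CSucc. Qed.

Lemma computable_nfst f : computable f -> computable (fun x => nfst (f x)).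
Proof. by apply: computable_comp; exists CFst. Qed.

Lemma computable_nsnd f : computable f -> computable (fun x => nsnd (f x)).
Proof. by apply: computable_comp; exists CSnd. Qed.

Lemma computable_const n : computable (fun=> n).
Proof.
elim: n => [|n ihn]; first by exists CZero.
exact: computable_succ.
Qed.

Lemma computable_npair f g :
  computable f -> computable g -> computable (fun x => npair (f x) (g x)).
Proof.
by move=> [c hc] [d hd]; exists (CPair c d) => x; exists (f x), (g x).
Qed.

Lemma computable_iteri (b n : nat -> nat) (g : nat -> nat -> nat -> nat) :
  computable b -> computable n ->
  computable (fun p => g (nfst p) (nfst (nsnd p)) (nsnd (nsnd p))) ->
  computable (fun x => iteri (n x) (g x) (b x)).
Proof.
move=> [cb hb] [cn hn] [cg hg].
have [cid hid] := computable_id.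
exists (CComp (CPrec cb cg) (CPair cid cn)) => x.
exists (npair x (n x)); first by exists x, (n x).
rewrite /= !npairK; elim: (n x) => [|m ihm] /=; first by constructor.
apply: PrecS ihm _.
by have := hg (npair x (npair m (iteri m (g x) (b x)))); rewrite !npairK.
Qed.

Lemma computable_pred f : computable f -> computable (fun x => (f x).-1).
Proof.
apply: computable_comp.
have [c hc] : computable (fun x => iteri x (fun i _ => i) 0).
  apply: (computable_iteri (g := fun _ i _ => i)).
  - exact: computable_const.
  - exact: computable_id.
  - by apply: computable_nfst; apply: computable_nsnd; apply: computable_id.
by exists c => -[|x]; [exact: hc 0|exact: hc x.+1].
Qed.

Lemma computable_iter (b n : nat -> nat) (g : nat -> nat) :
  computable b -> computable n -> computable g ->
  computable (fun x => iter (n x) g (b x)).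
Proof.
move=> hb hn hg.
have [c hc] : computable (fun x => iteri (n x) (fun _ => g) (b x)).
  apply: (computable_iteri (g := fun _ _ => g)) => //.
  by apply: computable_comp => //; do 2!apply: computable_nsnd; apply: computable_id.
exists c => x; have := hc x.
suff -> : iteri (n x) (fun _ => g) (b x) = iter (n x) g (b x) by [].
by elim: (n x) => //= m ->.
Qed.

Lemma computable_sub f g :
  computable f -> computable g -> computable (fun x => f x - g x).
Proof.
move=> hf hg.
have [c hc] : computable (fun x => iter (g x) predn (f x)).
  by apply: computable_iter => //; apply: computable_pred; apply: computable_id.
exists c => x; have := hc x.
suff -> : iter (g x) predn (f x) = f x - g x by [].
by elim: (g x) => /= [|m ->]; lia.
Qed.

Definition computable_bool (p : nat -> bool) : Prop :=
  computable (fun x => nat_of_bool (p x)).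

(** Branching is an iteration of length [p x], that is zero or one, which starts from [g x] and
    whose turn returns [f x]. *)
Lemma computable_if (p : nat -> bool) f g :
  computable_bool p -> computable f -> computable g ->
  computable (fun x => if p x then f x else g x).
Proof.
move=> hp hf hg.
have [c hc] : computable (fun x => iteri (p x) (fun _ _ => f x) (g x)).
  apply: (computable_iteri (g := fun x _ _ => f x)) => //.
  by apply: computable_comp => //; apply: computable_nfst; apply: computable_id.
by exists c => x; have := hc x; case: (p x).
Qed.

Lemma computable_and (p q : nat -> bool) :
  computable_bool p -> computable_bool q -> computable_bool (fun x => p x && q x).
Proof.
move=> hp hq.
have [c hc] := computable_if hp hq (computable_const 0).
by exists c => x; have := hc x; case: (p x).
Qed.

Lemma computable_or (p q : nat -> bool) :
  computable_bool p -> computable_bool q -> computable_bool (fun x => p x || q x).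
Proof.
move=> hp hq.
have [c hc] := computable_if hp (computable_const 1) hq.
by exists c => x; have := hc x; case: (p x).
Qed.

Lemma computable_leq f g :
  computable f -> computable g -> computable_bool (fun x => f x <= g x).
Proof.
move=> hf hg.
have [c hc] := computable_sub (computable_const 1) (computable_sub hf hg).
exists c => x; have := hc x.
by suff -> : 1 - (f x - g x) = (f x <= g x) by []; lia.
Qed.

Lemma computable_eq f g :
  computable f -> computable g -> computable_bool (fun x => f x == g x).
Proof.
move=> hf hg.
have [c hc] := computable_and (computable_leq hf hg) (computable_leq hg hf).
by exists c => x; have := hc x; rewrite eqn_leq.
Qed.

(** * Reading and building encoded tables *)

(** [enc_seq] codes a cons cell as the successor of a pair, so a predecessor precedes each
    projection. Beyond the end of the sequence the value is junk. *)
Definition dnth (t i : nat) : nat := nfst (iter i (fun u => nsnd u.-1) t).-1.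

Lemma dnth_enc_seq T (enc : T -> nat) x0 s i :
  i < size s -> dnth (enc_seq enc s) i = enc (nth x0 s i).
Proof.
rewrite /dnth; elim: s i => //= a s ih [|i] hi; first by rewrite npairK.
by rewrite -ih // iterSr /= npairK.
Qed.

Lemma dnth_enc_fun k T (enc : T -> nat) (f : 'I_k -> T) (i : 'I_k) :
  dnth (enc_fun enc f) i = enc (f i).
Proof.
rewrite /enc_fun (dnth_enc_seq _ i) ?size_enum_ord //.
by rewrite nth_ord_enum.
Qed.

Lemma computable_dnth f g :
  computable f -> computable g -> computable (fun x => dnth (f x) (g x)).
Proof.
move=> hf hg; rewrite /dnth; apply: computable_nfst; apply: computable_pred.
apply: computable_iter => //.
by apply: computable_nsnd; apply: computable_pred; apply: computable_id.
Qed.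

Lemma enc_seq_map T U (enc : U -> nat) (f : T -> U) s :
  enc_seq enc (map f s) = enc_seq (fun x => enc (f x)) s.
Proof. by elim: s => //= x s ->. Qed.

Lemma eq_enc_seq T (enc enc' : T -> nat) s :
  enc =1 enc' -> enc_seq enc s = enc_seq enc' s.
Proof. by move=> h; elim: s => //= x s ->; rewrite h. Qed.

(** Replaces ordinals by [iota], so that the code of a table becomes accessible to numerical
    recursion. *)
Lemma enc_funE k T (enc : T -> nat) (f : 'I_k -> T) (g : nat -> nat) :
  (forall i : 'I_k, g i = enc (f i)) -> enc_fun enc f = enc_seq g (iota 0 k).
Proof.
move=> h; rewrite -val_enum_ord enc_seq_map.
by apply: eq_enc_seq => i; rewrite h.
Qed.

Ltac computable_step :=
  match goal with
  | |- computable _ => assumption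
  | |- computable_bool _ => assumption
  | |- computable (fun _ => ?c) => exact: computable_const
  | |- computable_bool (fun _ => ?c) => exact: computable_const
  | |- computable (fun x => x) => exact: computable_id
  | |- computable nfst => exact: (computable_nfst computable_id)
  | |- computable nsnd => exact: (computable_nsnd computable_id)
  | |- computable (fun x => nfst (@?f1 x)) => apply: computable_nfst
  | |- computable (fun x => nsnd (@?f1 x)) => apply: computable_nsnd
  | |- computable (fun x => npair (@?f1 x) (@?f2 x)) => apply: computable_npair
  | |- computable (fun x => dnth (@?f1 x) (@?f2 x)) => apply: computable_dnth
  | |- computable (fun x => subn (@?f1 x) (@?f2 x)) => apply: computable_sub
  | |- computable (fun x => predn (@?f1 x)) => apply: computable_pred
  | |- computable (fun x => S (@?f1 x)) => apply: computable_succ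
  | |- computable_bool (fun x => andb (@?f1 x) (@?f2 x)) => apply: computable_and
  | |- computable_bool (fun x => orb (@?f1 x) (@?f2 x)) => apply: computable_or
  | |- computable_bool (fun x => leq (@?f1 x) (@?f2 x)) => apply: computable_leq
  | |- computable_bool (fun x => eq_op (@?f1 x) (@?f2 x)) => apply: computable_eq
  | |- computable _ => apply: computable_if
  end.
Ltac computable_tac := repeat computable_step.

(* Only the entries of the table need to be computed: c may diverge elsewhere. *)
Lemma eval_table c cn : exists t, forall a k T (enc : T -> nat) (f : 'I_k -> T),
  eval cn a k -> (forall i : 'I_k, eval c (npair a i) (enc (f i))) ->
  eval t a (enc_fun enc f).
Proof.
have [cid hid] := computable_id.
(* The table is built from its end: step u prepends entry k - u.+1. *)
have [cix hix] : computable (fun v =>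
    npair (nfst (nfst v)) (nsnd (nfst v) - (nfst (nsnd v)).+1)).
  by computable_tac.
pose cstep := CComp CSucc (CPair (CComp c cix) (CComp CSnd CSnd)).
exists (CComp (CPrec CZero cstep) (CComp (CPair cid CSnd) (CPair cid cn))).
move=> a k T enc f hn hf.
(* The default 0 is never read: only indices below [k] occur. *)
pose g i := if insub i is Some o then enc (f o) else 0.
have hg (i : 'I_k) : g i = enc (f i) by rewrite /g valK.
rewrite (enc_funE hg).
exists (npair (npair a k) k).
  exists (npair a k); first by exists a, k.
  by exists (npair a k), k; split=> //=; rewrite npairK.
rewrite /= !npairK.
(* After [m] turns the accumulator codes the last [m] entries of the table. *)
suff H m : m <= k ->
    prec_graph (eval CZero) (eval cstep) (npair a k) m
      (enc_seq g (iota (k - m) m)).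
  by have := H k (leqnn k); rewrite subnn.
elim: m => [|m ihm] hm; first by constructor.
apply: PrecS (ihm (ltnW hm)) _.
set acc := enc_seq _ _.
have hk : k - m.+1 < k by lia.
have hgk := hf (Ordinal hk).
exists (npair (g (k - m.+1)) acc); last first.
  have -> : iota (k - m.+1) m.+1 = (k - m.+1) :: iota (k - m) m.
    by rewrite /=; congr (_ :: iota _ _); lia.
  by [].
exists (g (k - m.+1)), acc; split => //; last first.
  by exists (npair m acc); rewrite /= !npairK.
exists (npair a (k - m.+1)); last by rewrite (hg (Ordinal hk)).
by have := hix (npair (npair a k) (npair m acc)); rewrite !npairK.
Qed.

Lemma computable_table (n : nat -> nat) (g : nat -> nat -> nat) :
  computable n -> computable (fun p => g (nfst p) (nsnd p)) ->
  computable (fun x => enc_seq (g x) (iota 0 (n x))).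
Proof.
move=> [cn hn] [cg hg]; have [t ht] := eval_table cg cn.
exists t => x; rewrite -(enc_funE (f := fun i : 'I__ => g x i) (enc := id)) //.
by apply: ht => // i; have := hg (npair x i); rewrite !npairK.
Qed.

(** * Runs, fairness and lassos *)

(* Multisets are functions compared pointwise; steps subtract the executed handler
   instead of exhibiting the remaining multiset. *)
Section System.
Variables (S : Type) (H : eqType) (L : S -> H -> S -> seq H -> Prop).

Definition fire (s : S) (m : H -> nat) (h : H) (s' : S) (m' : H -> nat) : Prop :=
  0 < m h /\
  exists2 w, L s h s' w & forall x, m' x = m x - (x == h) + count_mem x w.

Fixpoint exec (s : S) (m : H -> nat) (tr : seq H) (s' : S) (m' : H -> nat) :
    Prop :=
  match tr with
  | [::] => s = s' /\ m =1 m'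
  | h :: tr => exists s1 m1, fire s m h s1 m1 /\ exec s1 m1 tr s' m'
  end.

Lemma fire_ext s m n h s' m' n' :
  m =1 n -> m' =1 n' -> fire s m h s' m' -> fire s n h s' n'.
Proof.
move=> e e' [h1 [w hw h2]]; split; first by rewrite -e.
by exists w => // x; rewrite -e -e'.
Qed.

Lemma exec_ext s m n tr s' m' n' :
  m =1 n -> m' =1 n' -> exec s m tr s' m' -> exec s n tr s' n'.
Proof.
elim: tr s m n => [|h tr ih] s m n e e' /=.
  by case=> -> h; split=> // x; rewrite -e -e'.
move=> [s1 [m1 [h1 h2]]]; exists s1, m1; split; first exact: fire_ext h1.
exact: ih h2.
Qed.

Lemma exec_cat s m tr1 s1 m1 tr2 s2 m2 :
  exec s m tr1 s1 m1 -> exec s1 m1 tr2 s2 m2 -> exec s m (tr1 ++ tr2) s2 m2.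
Proof.
elim: tr1 s m => [|h tr ih] s m /=.
  by move=> [-> e]; apply: exec_ext => // x; rewrite e.
move=> [s' [m' [h1 h2]]] h3; exists s', m'; split=> //.
exact: ih h2 h3.
Qed.

Lemma exec_fire s m h s' m' : fire s m h s' m' -> exec s m [:: h] s' m'.
Proof. by move=> hf; exists s', m'. Qed.

Lemma exec_rcons s m tr h s' m' : exec s m (rcons tr h) s' m' ->
  exists s1 m1, exec s m tr s1 m1 /\ fire s1 m1 h s' m'.
Proof.
elim: tr s m => [|a tr ih] s m /=.
  move=> [s1 [m1 [h1 [<- e]]]]; exists s, m; split=> //.
  exact: fire_ext h1.
move=> [s1 [m1 [h1 /ih [s2 [m2 [h2 h3]]]]]].
by exists s2, m2; split=> //; exists s1, m1.
Qed.

(** Induction on the trace from the right, so that the invariant may refer to the part already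
    executed. *)
Lemma exec_inv (I : S -> (H -> nat) -> seq H -> Prop) s m :
  (forall n, m =1 n -> I s n [::]) ->
  (forall s1 m1 tr h s2 m2, I s1 m1 tr -> fire s1 m1 h s2 m2 ->
     I s2 m2 (rcons tr h)) ->
  forall tr s' m', exec s m tr s' m' -> I s' m' tr.
Proof.
move=> h0 hS; elim/last_ind => [|tr h ih] s' m'.
  by move=> [<-]; apply: h0.
by move=> /exec_rcons [s1 [m1 [/ih h1 h2]]]; apply: hS h1 h2.
Qed.

Lemma fire_frame s m h s' m' b : fire s m h s' m' ->
  fire s (fun x => m x + b x) h s' (fun x => m' x + b x).
Proof.
move=> [h1 [w hw e]]; split; first lia.
exists w => // x; rewrite e; case: eqP => [->|_]; lia.
Qed.

Lemma fire_pending s m h s' m' x : fire s m h s' m' -> x != h -> m x <= m' x.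
Proof. by move=> [_ [w _ ->]] /negbTE ->; lia. Qed.

Lemma exec_pending s m tr s' m' x :
  exec s m tr s' m' -> x \notin tr -> m x <= m' x.
Proof.
elim: tr s m => [|h tr ih] s m /=; first by move=> [_ ->].
move=> [s1 [m1 [h1 h2]]]; rewrite inE negb_or => /andP [hx htr].
exact: leq_trans (fire_pending h1 hx) (ih _ _ h2 htr).
Qed.

(* The loop [tr2] can be repeated for ever, and the resulting run is fair.  If [fl]
   holds, then [b] is one instance of a handler that no turn of the loop consumes:
   this handler is starved. *)
Definition lasso (fl : bool) (s0 : S) (m0 : H -> nat) : Prop :=
  exists s m b m' tr1 tr2,
    [/\ exec s0 m0 tr1 s (fun x => m x + b x), exec s m tr2 s m',
        forall x, m x <= m' x, tr2 <> [::] &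
        (forall x, x \in tr2 \/ m' x + b x = 0) /\
        (if fl then exists y, forall x, b x = (x == y) else forall x, b x = 0)].

End System.

(** * Dickson's lemma *)

(** A smaller later value can replace [u k] only finitely often; the induction is on a bound for
    [u k]. *)
Lemma min_tail (u : nat -> nat) N :
  exists2 k, N <= k & forall j, N <= j -> u k <= u j.
Proof.
have H n : forall k, N <= k -> u k <= n ->
    exists2 k, N <= k & forall j, N <= j -> u k <= u j.
  elim: n => [|n ihn] k hk hu; first by exists k => // j _; lia.
  case: (classic (exists2 j, N <= j & u j < u k)) => [[j hj hlt]|hn].
    by apply: (ihn j) => //; lia.
  exists k => // j hj; case: (leqP (u k) (u j)) => // hlt.
  by case: hn; exists j.
exact: (H (u N) N).
Qed.

Definition increasing (phi : nat -> nat) := {homo phi : i j / i < j}.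

Lemma increasing_leq phi : increasing phi -> {homo phi : i j / i <= j}.
Proof.
move=> h i j; rewrite leq_eqVlt => /predU1P [-> //|/h]; exact: ltnW.
Qed.

Lemma increasing_id phi i : increasing phi -> i <= phi i.
Proof. by move=> h; elim: i => // i ih; apply: leq_ltn_trans ih (h _ _ _). Qed.

(** Each next index is the position of a minimum of [u] on the tail strictly after the previous
    index; minima of shrinking tails do not decrease. *)
Lemma nondecreasing_subsequence (u : nat -> nat) :
  exists2 phi, increasing phi & {homo (u \o phi) : i j / i <= j}.
Proof.
have [f hf] := functional_choice (fun N k => N <= k /\ forall j, N <= j -> u k <= u j)
  (fun N => let: ex_intro2 k h1 h2 := min_tail u N in ex_intro _ k (conj h1 h2)).
pose phi := fix phi k := if k is k'.+1 then f (phi k').+1 else f 0.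
have phiS k : phi k < phi k.+1 by have [] := hf (phi k).+1.
exists phi; first by apply: homo_ltn => // i j k; apply: ltn_trans.
have step k : u (phi k) <= u (phi k.+1).
  (* [phi k] is the chosen minimum of some tail, and that tail also contains [phi k.+1]. *)
  have hk : exists2 N, phi k = f N & N <= phi k.
    by case: k => [|k]; [exists 0|exists (phi k).+1 => //=; have [] := hf (phi k).+1].
  have [N e hN] := hk.
  rewrite {1}e; have [_] := hf N; apply.
  exact: leq_trans hN (ltnW (phiS k)).
by apply: homo_leq => // i j k; apply: leq_trans.
Qed.

(** Induction on the coordinates: a subsequence good for the others is thinned out to be
    nondecreasing in the new one. The conjunction is a [foldr] because [T] has no decidable
    equality. *)
Lemma dickson (T : Type) (s : seq T) (u : T -> nat -> nat) :
  exists2 phi, increasing phi &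
    forall i j, i <= j -> foldr (fun x P => u x (phi i) <= u x (phi j) /\ P) True s.
Proof.
elim: s => [|x s [phi h1 h2]]; first by exists id.
have [psi h3 h4] := nondecreasing_subsequence (u x \o phi).
exists (phi \o psi) => [i j hij|i j hij] /=; first by apply/h1/h3.
by split; [apply: h4|apply: h2; apply: increasing_leq].
Qed.

Lemma dickson_fin (T : finType) (u : T -> nat -> nat) :
  exists2 phi, increasing phi &
    forall i j, i <= j -> forall x, u x (phi i) <= u x (phi j).
Proof.
have [phi h1 h2] := dickson (enum T) u; exists phi => // i j hij x.
have := h2 _ _ hij; have : x \in enum T by rewrite mem_enum.
elim: (enum T) => //= y s ih; rewrite inE => /predU1P [<- [] //|hx [_]].
exact: ih.
Qed.

Lemma dickson_state d (T : finType) (v : nat -> 'I_d) (u : T -> nat -> nat) :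
  exists2 phi, increasing phi &
    forall i j, i <= j -> v (phi i) = v (phi j) /\
      forall x, u x (phi i) <= u x (phi j).
Proof.
(* If both v and d - v are nondecreasing along phi, then v is constant there. *)
pose w (x : bool + T) i := match x with
  inl true => nat_of_ord (v i) | inl false => d - v i | inr x => u x i end.
have [phi h1 h2] := dickson_fin w; exists phi => // i j hij; split.
  apply: val_inj; have := h2 _ _ hij (inl true); have := h2 _ _ hij (inl false).
  by rewrite /w /=; have := ltn_ord (v (phi i)); have := ltn_ord (v (phi j)); lia.
by move=> x; apply: (h2 _ _ hij (inr x)).
Qed.

Lemma eventually_all (T : finType) (P : T -> nat -> Prop) :
  (forall x, exists N, forall j, N <= j -> P x j) ->
  exists N, forall j, N <= j -> forall x, P x j.
Proof.
move=> h; have [f hf] := fin_all_exists h.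
exists (\max_x f x) => j hj x; apply: hf.
exact: leq_trans (leq_bigmax x) hj.
Qed.

(** * Infinite fair runs and lassos *)

Section Program.
Variables (C : lang_class) (P : async_prog).

Definition prog_lang (d : 'I_(states P)) (s : 'I_(handlers P))
    (d' : 'I_(states P)) (w : seq 'I_(handlers P)) : Prop :=
  lang C (ctx_rep P d s d') w.

Local Notation pexec := (exec prog_lang).

Definition cfg (d : 'I_(states P)) (m : 'I_(handlers P) -> nat) : config P :=
  (d, [ffun x => m x]).

Lemma stepE (c : config P) s (c' : config P) :
  step C c s c' <-> fire prog_lang c.1 c.2 s c'.1 c'.2.
Proof.
split.
  move=> [m [w [e hw e']]]; split; first by rewrite e !ffunE eqxx; lia.
  by exists w => // x; rewrite e e' !ffunE addnK.
move=> [h0 [w hw e]]; exists [ffun x => c.2 x - (x == s)], w; split=> //.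
  by apply/ffunP => x; rewrite !ffunE subnK //; case: eqP => [->|].
by apply/ffunP => x; rewrite !ffunE e.
Qed.

Lemma steps_exec (c : config P) r : steps C c r ->
  let c' := last c (map snd r) in pexec c.1 c.2 (map fst r) c'.1 c'.2.
Proof.
elim: r c => [|[s c'] r ih] c //= [/stepE h1 /ih h2].
by exists c'.1, c'.2.
Qed.

Lemma exec_steps (c : config P) tr d m : pexec c.1 c.2 tr d m ->
  exists r, [/\ steps C c r, map fst r = tr & last c (map snd r) = cfg d m].
Proof.
elim: tr c => [|s tr ih] c /=.
  move=> [e1 e2]; exists [::]; split=> //=; rewrite [c]surjective_pairing e1.
  by congr pair; apply/ffunP => x; rewrite ffunE -e2.
move=> [d1 [m1 [h1 h2]]].
have [|r [h3 h4 h5]] := ih (cfg d1 m1).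
  by apply: exec_ext h2 => // x; rewrite ffunE.
exists ((s, cfg d1 m1) :: r); split => //=; last by rewrite h4.
by split=> //; apply/stepE; apply: fire_ext h1 => // x; rewrite ffunE.
Qed.

Lemma run_exec (c : nat -> config P) (s : nat -> 'I_(handlers P)) i k :
  (forall i, step C (c i) (s i) (c i.+1)) ->
  pexec (c i).1 (c i).2 [seq s j | j <- iota i k] (c (i + k)).1 (c (i + k)).2.
Proof.
move=> h; elim: k i => [|k ih] i /=; first by rewrite addn0.
exists (c i.+1).1, (c i.+1).2; split; first exact/stepE.
by rewrite addnS -addSn.
Qed.

Lemma reachableE (x : config P) :
  reachable C x <-> exists tr, pexec (state0 P) (mset0 P) tr x.1 x.2.
Proof.
split.
  move=> [[r hr hx]|[c [s [[h0 h] [i <-]]]]].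
    have {hx} [r1 [r2 [e ->]]] : exists r1 r2,
        r = r1 ++ r2 /\ x = last (config0 P) (map snd r1).
      move: hx; rewrite inE => /predU1P [->|]; first by exists [::], r.
      move=> /mapP [sc /path.splitPr [p1 p2] ->].
      by exists (rcons p1 sc), p2; rewrite cat_rcons map_rcons last_rcons.
    exists (map fst r1); have /= := @steps_exec (config0 P) r1; apply.
    move: hr; rewrite e /finite_run; elim: (r1) (config0 P) => //= sc r' ih c.
    by move=> [? /ih ?].
  by have := run_exec 0 i h; rewrite h0; exists [seq s j | j <- iota 0 i].
move=> [tr /(@exec_steps (config0 P)) [r [h1 _ h2]]]; left; exists r => //.
have -> : x = last (config0 P) (map snd r).
  rewrite h2 [LHS]surjective_pairing; congr pair.
  by apply/ffunP => y; rewrite ffunE.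
exact: mem_last.
Qed.

Lemma steps_nth (c : config P) r s0 i : steps C c r -> i < size r ->
  step C (nth c (c :: map snd r) i) (nth s0 (map fst r) i)
    (nth c (c :: map snd r) i.+1).
Proof.
elim: r c i => [|sc r ih] c [|i] //= [h1 h2] hi //.
have hi' : i < size r by lia.
have := ih _ _ h2 hi'; rewrite /=.
case: i hi hi' => [|i] hi hi' //=; first by case: (r) hi'.
by rewrite !(set_nth_default c sc.2) ?size_map //; lia.
Qed.

Definition shift (c : config P) (k : 'I_(handlers P) -> nat) : config P :=
  cfg c.1 (fun x => c.2 x + k x).

Lemma step_shift (c : config P) s (c' : config P) k :
  step C c s c' -> step C (shift c k) s (shift c' k).
Proof.
move=> /stepE h; apply/stepE.
by apply: fire_ext (fire_frame k h) => x; rewrite ffunE.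
Qed.

(* The run follows [tr1] and then repeats [tr2]; each turn of this loop adds
   the same surplus m' - m to the multiset. *)
Lemma lasso_run fl : lasso prog_lang fl (state0 P) (mset0 P) ->
  exists (c : nat -> config P) (s : nat -> 'I_(handlers P)),
    [/\ infinite_run C c s, fair c s & fl -> exists x, starves c s x].
Proof.
move=> [d [m [b [m' [tr1 [tr2 [hx1 hx2 hle hne [hin hb]]]]]]]].
have [r1 [hs1 hf1 hl1]] := exec_steps (c := config0 P) hx1.
have [r2 [hs2 hf2 hl2]] := exec_steps (c := cfg d m)
  (exec_ext (fun x => esym (ffunE _ x)) (frefl _) hx2).
have [x0 hx0] : exists x, x \in tr2.
  by case: (tr2) hne => // x s _; exists x; rewrite mem_head.
pose p := size r1; pose l := size r2.
have l_gt0 : 0 < l by rewrite /l -(size_map fst) hf2; case: (tr2) hx0.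
(* The surplus in turn [q]: the part set aside plus the growth of [q] turns. *)
pose k q x := b x + q * (m' x - m x).
pose loop r := nth (cfg d m) (cfg d m :: map snd r2) r.
pose c i := if i < p then nth (config0 P) (config0 P :: map snd r1) i
            else shift (loop ((i - p) %% l)) (k ((i - p) %/ l)).
pose s i := if i < p then nth x0 tr1 i else nth x0 tr2 ((i - p) %% l).
have cp q r : r < l -> c (p + (q * l + r)) = shift (loop r) (k q).
  move=> hr; rewrite /c ltnNge leq_addr /= addKn modnMDl modn_small //.
  by rewrite divnMDl // divn_small // addn0.
have sp q r : r < l -> s (p + (q * l + r)) = nth x0 tr2 r.
  by move=> hr; rewrite /s ltnNge leq_addr /= addKn modnMDl modn_small.
(* The end of a turn is the start of the next one with a larger surplus, because [m] is below
   [m']. *)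
have loopl q : shift (loop l) (k q) = c (p + q.+1 * l).
  rewrite -[q.+1 * l]addn0 cp // /loop /l -(size_map snd r2) /=.
  rewrite -last_nth hl2; congr pair; apply/ffunP => x; rewrite !ffunE /k /=.
  by have := hle x; lia.
have c_p : nth (config0 P) (config0 P :: map snd r1) p = c p.
  rewrite /c ltnn subnn mod0n div0n /p -(size_map snd r1) -last_nth hl1.
  by congr pair; apply/ffunP => x; rewrite !ffunE /k /=; lia.
have hstep i : step C (c i) (s i) (c i.+1).
  case: (ltnP i p) => hi.
    have -> : c i.+1 = nth (config0 P) (config0 P :: map snd r1) i.+1.
      case: (ltnP i.+1 p) => hi'; first by rewrite /c hi'.
      have e : i.+1 = p by lia.
      by rewrite e c_p.
    by rewrite /c /s hi -hf1; apply: steps_nth.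
  rewrite -(subnKC hi) (divn_eq (i - p) l).
  set q := _ %/ _; set r := _ %% _.
  have hr : r < l by apply: ltn_pmod.
  rewrite cp // sp // -hf2 -addnS -addnS.
  have := step_shift (k q) (steps_nth x0 hs2 hr).
  case: (ltnP r.+1 l) => hr'; first by rewrite (cp q r.+1).
  have e : r.+1 = l by lia.
  have -> : q * l + r.+1 = q.+1 * l by rewrite mulSn e addnC.
  by rewrite -loopl -e.
have often x j : x \in tr2 -> exists2 i, j <= i & s i = x.
  move=> hx; exists (p + (j * l + index x tr2)).
    by have := leq_mul (leqnn j) l_gt0; lia.
  by rewrite sp ?nth_index // /l -(size_map fst) hf2 index_mem.
have run : infinite_run C c s.
  split=> //; rewrite /c; case: ifP => // hp0.
  have e : p = 0 by lia.
  by move: c_p; rewrite e /c hp0 e => <-.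
exists c, s; split=> //.
  move=> i x hi; case: (hin x) => [|h0]; first exact: often.
  (* A handler pending at [i] and never executed afterwards would still be pending at the start of
     turn [i.+1], which comes later; but there its count is 0. *)
  apply: NNPP => hn.
  have hj : i <= p + i.+1 * l.
    by have := leq_mul (leqnn i.+1) l_gt0; lia.
  have never : x \notin [seq s j | j <- iota i (p + i.+1 * l - i)].
    by apply/mapP => -[j]; rewrite mem_iota => /andP [hj' _] e; case: hn; exists j.
  have := exec_pending (run_exec i (p + i.+1 * l - i) hstep) never.
  rewrite subnKC // -[i.+1 * l]addn0 cp // /loop /= !ffunE /k.
  have -> : m' x - m x = 0 by lia.
  by have := hle x; lia.
move=> fl1; move: hb; rewrite fl1 => -[y hb]; exists y, p => j hj.
rewrite -(subnKC hj) (divn_eq (j - p) l).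
set q := _ %/ _; set r := _ %% _.
have hr : r < l by apply: ltn_pmod.
rewrite cp // sp // /= ffunE /k hb eqxx /=.
move: (q * _) => z; split; first by lia.
(* The loop is executable without [b], so an executed [y] has an instance besides the one set
   aside. *)
move=> e; have /stepE [h _] := steps_nth x0 hs2 hr.
by move: h; rewrite hf2 e -/(loop r); lia.
Qed.

(** Converse of [fire_frame]: the step does not need [b] if its handler has an instance outside
    [b]. *)
Lemma fire_unframe s m h s' m' b :
  fire prog_lang s (fun x => m x + b x) h s' (fun x => m' x + b x) ->
  0 < m h -> fire prog_lang s m h s' m'.
Proof.
move=> [_ [w hw e]] h0; split=> //; exists w => // x.
by have := e x; case: eqP => [->|_]; lia.
Qed.

Lemma run_lasso (fl : bool) (c : nat -> config P) (s : nat -> 'I_(handlers P)) :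
  infinite_run C c s -> fair c s -> (fl -> exists x, starves c s x) ->
  lasso prog_lang fl (state0 P) (mset0 P).
Proof.
move=> [c0 hstep] hfair hst.
have [b [N0 [hb hfl]]] : exists (b : 'I_(handlers P) -> nat) N0,
    (forall j, N0 <= j -> forall x, b x <= (c j).2 x /\ (s j = x -> b x < (c j).2 x))
    /\ (if fl then exists y, forall x, b x = (x == y) else forall x, b x = 0).
  case: (fl) hst => [/(_ isT) [y [J hJ]]|_].
    exists (fun x => x == y), J; split=> [j hj x|]; last by exists y.
    have [h1 h2] := hJ _ hj.
    have /stepE [h3 _] := hstep j.
    by case: eqP => [->//|_]; split=> // e; rewrite -e.
  exists (fun=> 0), 0; split=> // j _ x; split=> // <-.
  by have /stepE [] := hstep j.
have [phi hphi hmono] := dickson_state (fun i => (c i).1) (fun x i => (c i).2 x).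
pose i := phi N0.
have hi : N0 <= i by exact: (increasing_id _ hphi).
(* Beyond [B], every handler executed at or after [i] has already been executed since [i]. *)
have [B hB] : exists N, forall j, N <= j -> forall x,
    x \in [seq s k | k <- iota i (j - i)] \/ forall k, i <= k -> s k <> x.
  apply: eventually_all => x.
  case: (classic (exists2 k, i <= k & s k = x)) => [[k hk e]|hn].
    exists k.+1 => j hj; left; apply/mapP; exists k => //.
    by rewrite mem_iota; lia.
  by exists 0 => j _; right => k hk e; apply: hn; exists k.
(* [N0] makes the two positions comparable, [B] makes the loop contain all recurring handlers, and
   [i.+1] makes it nonempty. *)
pose a := maxn N0 (maxn B i.+1); pose j := phi a.
have hj : a <= j by exact: (increasing_id _ hphi).
have haN : N0 <= a by apply: leq_maxl.
have [hd hle] := hmono _ _ haN.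
have cb k : i <= k -> forall x, (c k).2 x = (c k).2 x - b x + b x.
  by move=> hk x; have [] := hb k ltac:(lia) x; lia.
have hex n i' : i <= i' ->
    pexec (c i').1 (fun x => (c i').2 x - b x) [seq s k | k <- iota i' n]
      (c (i' + n)).1 (fun x => (c (i' + n)).2 x - b x).
  elim: n i' => [|n ih] i' hi' /=; first by rewrite addn0.
  exists (c i'.+1).1, (fun x => (c i'.+1).2 x - b x); split; last first.
    by rewrite addnS -addSn; apply: ih; lia.
  have /stepE hf := hstep i'.
  apply: (@fire_unframe _ _ _ _ _ b).
    by apply: fire_ext hf => x; apply: cb; lia.
  by have [_ /(_ erefl)] := hb i' ltac:(lia) (s i'); lia.
exists (c i).1, (fun x => (c i).2 x - b x), b, (fun x => (c j).2 x - b x).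
exists [seq s k | k <- iota 0 i], [seq s k | k <- iota i (j - i)]; split.
- have := run_exec 0 i hstep; rewrite c0; apply: exec_ext => // x.
  by apply: cb.
- have ij : i <= j by lia.
  by have := hex (j - i) i (leqnn i); rewrite subnKC // [(c j).1](esym hd).
- by move=> x; apply: leq_sub2r.
- have : 0 < j - i by lia.
  by case: (j - i).
split=> // x; case: (hB j ltac:(lia) x) => [|hn]; [by left|right].
(* By fairness a handler that is not executed any more is not pending at [j]. *)
have {}hn : (c j).2 x = 0.
  case: (posnP ((c j).2 x)) => // /hfair [k hk e].
  by case: (hn k) => //; lia.
by have [] := hb j ltac:(lia) x; lia.
Qed.

Lemma fair_runE : (exists (c : nat -> config P) (s : nat -> 'I_(handlers P)),
    infinite_run C c s /\ fair c s) <->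
  lasso prog_lang false (state0 P) (mset0 P).
Proof.
split=> [[c [s [h1 h2]]]|/lasso_run [c [s [h1 h2 _]]]]; last by exists c, s.
exact: run_lasso h1 h2 _.
Qed.

Lemma starving_runE : (exists (c : nat -> config P) (s : nat -> 'I_(handlers P)),
    [/\ infinite_run C c s, fair c s & exists x, starves c s x]) <->
  lasso prog_lang true (state0 P) (mset0 P).
Proof.
split=> [[c [s [h1 h2 h3]]]|/lasso_run [c [s [h1 h2 h3]]]].
  by apply: run_lasso h1 h2 _.
by exists c, s; split=> //; apply: h3.
Qed.

End Program.

(** * Embedding abstract systems into asynchronous programs *)

Section Embedding.
Variables (S S2 : Type) (H : eqType) (H2 : finType).
Variables (L : S -> H -> S -> seq H -> Prop).
Variables (L2 : S2 -> H2 -> S2 -> seq H2 -> Prop).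
Variables (fS : S -> S2) (fH : H -> H2).

Definition extends0 (m : H -> nat) (m2 : H2 -> nat) : Prop :=
  (forall h, m2 (fH h) = m h) /\ forall j, 0 < m2 j -> exists h, j = fH h.

(** The last clause confines executions: from a state and a handler in the image, the next state and
    the posted handlers are in the image again. *)
Definition embedding : Prop :=
  [/\ injective fS, injective fH,
      forall s h s' w, L s h s' w -> L2 (fS s) (fH h) (fS s') (map fH w) &
      forall s h k w2, L2 (fS s) (fH h) k w2 ->
        exists s' w, [/\ k = fS s', w2 = map fH w & L s h s' w]].

Hypothesis emb : embedding.
Let fS_inj : injective fS. Proof. by case: emb. Qed.
Let fH_inj : injective fH. Proof. by case: emb. Qed.

Lemma extends0_exists m : exists m2, extends0 m m2.
Proof.
have [m2 hm2] : exists m2 : H2 -> nat, forall j,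
    (forall h, j = fH h -> m2 j = m h) /\ (0 < m2 j -> exists h, j = fH h).
  apply: (@fin_all_exists _ (fun=> nat) (fun j v =>
    (forall h, j = fH h -> v = m h) /\ (0 < v -> exists h, j = fH h))) => j.
  case: (classic (exists h, j = fH h)) => [[h ->]|hn].
    by exists (m h); split=> [h' /fH_inj -> //|_]; exists h.
  by exists 0; split=> // h hj; case: hn; exists h.
exists m2; split=> [h|j]; last by have [] := hm2 j.
by have [h1 _] := hm2 (fH h); apply: h1.
Qed.

Lemma extends0_eq m m' m2 m2' :
  extends0 m m2 -> extends0 m' m2' -> m =1 m' -> m2 =1 m2'.
Proof.
move=> [h1 h2] [h1' h2'] e j.
case: (posnP (m2 j)) => [z|/h2 [h ->]]; last by rewrite h1 h1' e.
case: (posnP (m2' j)) => [z'|/h2' [h ej]]; first by rewrite z z'.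
by rewrite ej h1 h1' e.
Qed.

Lemma extends0_restrict m m2 n2 : extends0 m m2 -> (forall j, n2 j <= m2 j) ->
  extends0 (n2 \o fH) n2.
Proof. by move=> [_ h2] hle; split=> // j hj; apply: h2; apply: leq_trans (hle j). Qed.

Let count_fH h w : count_mem (fH h) (map fH w) = count_mem h w.
Proof. by rewrite count_map; apply: eq_count => x /=; rewrite (inj_eq fH_inj). Qed.

Lemma fire_embed s m h s' m' m2 m2' : extends0 m m2 -> extends0 m' m2' ->
  fire L s m h s' m' -> fire L2 (fS s) m2 (fH h) (fS s') m2'.
Proof.
case: emb => _ _ hL _ [e1 e2] [e1' e2'] [h0 [w hw hm]].
split; first by rewrite e1.
exists (map fH w) => [|j]; first exact: hL.
case: (classic (exists x, j = fH x)) => [[x ->]|hn].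
  by rewrite e1' e1 hm count_fH (inj_eq fH_inj).
have -> : m2' j = 0 by case: (posnP (m2' j)) => // /e2'.
have -> : m2 j = 0 by case: (posnP (m2 j)) => // /e2.
suff /count_memPn -> : j \notin map fH w by [].
by apply/mapP => -[x _ e]; apply: hn; exists x.
Qed.

Lemma fire_pullback s m m2 j k m2' :
  extends0 m m2 -> fire L2 (fS s) m2 j k m2' ->
  exists h s' m', [/\ j = fH h, k = fS s', extends0 m' m2' & fire L s m h s' m'].
Proof.
case: emb => _ _ _ hR [e1 e2] [h0 [w2 hw2 hm]].
have [h ej] := e2 _ h0; rewrite ej in hw2 h0 hm.
have [s' [w [ek ew hw]]] := hR _ _ _ _ hw2.
exists h, s', (m2' \o fH); split=> //.
  split=> // i; rewrite hm ew => hi.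
  case: (posnP (m2 i)) => [z|/e2 //]; move: hi; rewrite z sub0n add0n.
  by rewrite -has_count => /hasP [_ /mapP [x _ ->] /eqP <-]; exists x.
split; first by rewrite -e1.
by exists w => // x; rewrite /= hm e1 ew count_fH (inj_eq fH_inj).
Qed.

Lemma exec_embed s m tr s' m' m2 m2' : extends0 m m2 -> extends0 m' m2' ->
  exec L s m tr s' m' -> exec L2 (fS s) m2 (map fH tr) (fS s') m2'.
Proof.
move=> e e'; elim: tr s m m2 e => [|h tr ih] s m m2 e /=.
  by move=> [-> em]; split=> //; apply: extends0_eq e e' em.
move=> [s1 [m1 [h1 h2]]]; have [n1 e1] := extends0_exists m1.
exists (fS s1), n1; split; [exact: fire_embed h1|exact: ih h2].
Qed.

Lemma exec_pullback s m m2 tr2 k m2' :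
  extends0 m m2 -> exec L2 (fS s) m2 tr2 k m2' ->
  exists tr s' m', [/\ tr2 = map fH tr, k = fS s', extends0 m' m2' &
    exec L s m tr s' m'].
Proof.
elim: tr2 s m m2 => [|j tr2 ih] s m m2 e /=.
  move=> [<- em]; exists [::], s, m; split=> //.
  by case: e => e1 e2; split=> [h|i]; rewrite -em //; apply: e2.
move=> [k1 [n1 [h1 h2]]].
have [h [s1 [m1 [-> ek e1 h3]]]] := fire_pullback e h1.
rewrite ek in h2; have [tr [s' [m' [-> -> e' h4]]]] := ih _ _ _ e1 h2.
by exists (h :: tr), s', m'; split=> //; exists s1, m1.
Qed.

Lemma reach_embedding s0 m0 m2 s m m2' :
  extends0 m0 m2 -> extends0 m m2' ->
  (exists tr, exec L2 (fS s0) m2 tr (fS s) m2') <->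
  exists tr, exec L s0 m0 tr s m.
Proof.
move=> e e'; split=> [[tr2 h]|[tr h]]; last first.
  by exists (map fH tr); apply: exec_embed h.
have [tr [s' [m' [_ /fS_inj es e'' h']]]] := exec_pullback e h.
exists tr; rewrite es; apply: exec_ext h' => // x.
by case: e' e'' => [<- _] [<- _].
Qed.

Lemma lasso_embedding fl s0 m0 m2 : extends0 m0 m2 ->
  lasso L2 fl (fS s0) m2 <-> lasso L fl s0 m0.
Proof.
move=> e; split; last first.
  move=> [s [m [b [m' [tr1 [tr2 [h1 h2 hle hne [hin hfl]]]]]]]].
  have [n en] := extends0_exists m; have [b2 eb] := extends0_exists b.
  have [n' en'] := extends0_exists m'.
  exists (fS s), n, b2, n', (map fH tr1), (map fH tr2); split.
  - apply: exec_embed h1 => //; split=> [h|j].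
      by case: en eb => [-> _] [-> _].
    case: (posnP (n j)) => [->|hj]; first by case: eb => _ hb /hb.
    by move=> _; case: en => _; apply.
  - exact: exec_embed h2.
  - move=> j; case: (posnP (n j)) => [-> //|].
    by case: en => en1 en2 /en2 [h ->]; rewrite en1; case: en' => -> _.
  - by case: (tr2) hne.
  split=> [j|].
    case: (classic (exists h, j = fH h)) => [[h ->]|hn].
      case: (hin h) => [hh|hh]; first by left; apply: map_f.
      by right; case: en' eb => [-> _] [-> _].
    right; case: (posnP (n' j)) => [->|]; last by case: en' => _ h /h /hn.
    by case: (posnP (b2 j)) => [->|] //; case: eb => _ h /h /hn.
  case: fl hfl => [[y hy]|hb].
    exists (fH y) => j; case: (classic (exists h, j = fH h)) => [[h ->]|hn].
      by rewrite (inj_eq fH_inj) -hy; case: eb.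
    have -> : b2 j = 0 by case: (posnP (b2 j)) => // ; case: eb => _ h /h.
    by case: eqP => // ej; case: hn; exists y.
  move=> j; case: (posnP (b2 j)) => //; case: eb => eb1 eb2 /eb2 [h ->].
  by rewrite eb1 hb.
move=> [k [n [b2 [n' [t1 [t2 [h1 h2 hle hne [hin hfl]]]]]]]].
have [tr1 [s [mb [_ ek emb1 h1']]]] := exec_pullback e h1.
have en : extends0 (n \o fH) n by apply: extends0_restrict emb1 _ => j; apply: leq_addr.
rewrite ek in h2 h1; have [tr2 [s' [m' [et /fS_inj es en' h2']]]] := exec_pullback en h2.
exists s, (n \o fH), (b2 \o fH), m', tr1, tr2; split.
- by apply: exec_ext h1' => // x; case: emb1 => <-.
- by rewrite es in h2' *.
- by move=> x /=; case: en' => <- _.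
- by move=> e0; apply: hne; rewrite et e0.
split=> [x|].
  case: (hin (fH x)) => [|hx]; last by right; rewrite /=; case: en' => <-.
  by rewrite et (mem_map fH_inj); left.
case: (fl) hfl => [[y hy]|hb] /=; last by move=> x /=.
(* The starved handler is pending at the start of the loop, hence lies in the image. *)
have [h eh] : exists h, y = fH h.
  by case: emb1 => _; apply; rewrite hy eqxx; lia.
by exists h => x /=; rewrite hy eh (inj_eq fH_inj).
Qed.

End Embedding.

(** * Compilation of uniformly described systems into programs *)

(** A language over abstract handlers, given as a homomorphic image of a language of the class. Once
    handlers are numbered, closure under homomorphic images turns this into a representation. *)
Record spec (H : Type) : Type := Spec {
  spec_arity : nat;
  spec_rep : nat;
  spec_hom : 'I_spec_arity -> seq H
}.

Arguments spec_hom {H} s _.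

Section Compilation.
Variable C : lang_class.

Definition spec_ok H (sp : spec H) : Prop := is_rep C (spec_arity sp) (spec_rep sp).

Definition spec_lang H (sp : spec H) (w : seq H) : Prop :=
  exists2 u, lang C (spec_rep sp) u & w = flatten (map (spec_hom sp) u).

(** Has the format of the inputs of the program in [closed_hom_image], for the target alphabet
    ['I_n]. *)
Definition spec_code H (n : nat) (eH : H -> nat) (sp : spec H) : nat :=
  npair (spec_arity sp) (npair n (npair (spec_rep sp)
    (enc_fun (enc_seq eH) (spec_hom sp)))).

Definition system (S : Type) (H : eqType) (Sp : S -> H -> S -> spec H)
  (s : S) (h : H) (s' : S) (w : seq H) : Prop := spec_lang (Sp s h s') w.

(** The last two clauses make the codes of target configurations computable from [eS] and [n]. *)
Definition implements (S : Type) (H : eqType) (Sp : S -> H -> S -> spec H)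
    (s0 : S) (m0 : H -> nat) (eS : S -> nat) (n : nat) (P : async_prog) : Prop :=
  exists (fS : S -> 'I_(states P)) (fH : H -> 'I_(handlers P)),
    [/\ embedding (system Sp) (prog_lang C (P := P)) fS fH,
        state0 P = fS s0, extends0 fH m0 (mset0 P),
        (forall s, fS s = eS s :> nat) & handlers P = n].

Lemma implements_lasso fl S H Sp s0 m0 eS n P :
  @implements S H Sp s0 m0 eS n P ->
  lasso (prog_lang C (P := P)) fl (state0 P) (mset0 P) <->
  lasso (system Sp) fl s0 m0.
Proof. move=> [fS [fH [h1 -> h3 _ _]]]. exact: lasso_embedding h3. Qed.

Lemma implements_reachable0 S H Sp s0 m0 eS n P s :
  @implements S H Sp s0 m0 eS n P ->
  exists c : config P,
    enc_config c = npair (eS s) (enc_seq (fun=> 0) (iota 0 n)) /\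
    (reachable C c <-> exists tr, exec (system Sp) s0 m0 tr s (fun=> 0)).
Proof.
move=> [fS [fH [h1 e0 h3 hS <-]]].
exists (fS s, [ffun=> 0]); split.
  by rewrite /enc_config /= hS (enc_funE (g := fun=> 0)) // => i; rewrite ffunE.
have hz : extends0 fH (fun=> 0) ([ffun=> 0] : multiset (handlers P)).
  by split=> [h|j]; rewrite ffunE.
rewrite reachableE e0; exact: (reach_embedding h1 s0 s h3 hz).
Qed.

Lemma flatten_map_map (T U V : Type) (f : T -> seq U) (g : U -> V) u :
  map g (flatten (map f u)) = flatten (map (fun x => map g (f x)) u).
Proof. by elim: u => //= x u <-; rewrite map_cat. Qed.

Hypothesis hC : closed_hom_image C.

(** From the code of the input, [N] and [M] compute the numbers of states and handlers, [i0] and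
    [mu] the initial configuration, and [num] the code of the specification of each context. The
    program for homomorphic images is applied to every value of [num], and the results form the
    table of representations. Indices that number no context must receive an empty language, which
    keeps executions inside the image. *)
Lemma compile (X : Type) (enc : X -> nat) (dom : X -> Prop)
    (S : X -> Type) (H : X -> eqType)
    (eS : forall x, S x -> nat) (eH : forall x, H x -> nat)
    (Sp : forall x, S x -> H x -> S x -> spec (H x))
    (s0 : forall x, S x) (m0 : forall x, H x -> nat)
    (N M i0 num : nat -> nat) (mu : nat -> nat -> nat) :
  computable N -> computable M -> computable i0 -> computable num ->
  computable (fun p => mu (nfst p) (nsnd p)) ->
  (forall x, dom x ->
    [/\ injective (@eS x), injective (@eH x),
        forall s, @eS x s < N (enc x) & forall h, @eH x h < M (enc x)] /\
    [/\ forall s h s', spec_ok (@Sp x s h s'),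
        forall s h s', num (npair (enc x) (npair (eS x s) (npair (eH x h) (eS x s'))))
          = spec_code (M (enc x)) (@eH x) (Sp x s h s'),
        forall i j k, (exists s h s', [/\ i = eS x s, j = eH x h & k = eS x s']) \/
          exists2 sp : spec (H x), spec_ok sp /\ (forall w, ~ spec_lang sp w) &
            num (npair (enc x) (npair i (npair j k))) =
              spec_code (M (enc x)) (@eH x) sp &
        [/\ i0 (enc x) = eS x (s0 x), forall h, mu (enc x) (eH x h) = m0 x h &
            forall j, 0 < mu (enc x) j -> exists h, j = eH x h]]) ->
  exists c, forall x, dom x -> exists P,
    [/\ prog_over C P, eval c (enc x) (enc_prog P) &
        implements (@Sp x) (s0 x) (@m0 x) (@eS x) (M (enc x)) P].
Proof.
move=> [cN hN] [cM hM] [ci hi] [cnum hnum] [cmu hmu] hx.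
case: hC => chom hhom.
have [cid hid] := computable_id.
(* Three nested tables yield the argument nested to the left; [num] expects it nested to the
   right. *)
have [ca ha] : computable (fun v => npair (nfst (nfst (nfst v)))
    (npair (nsnd (nfst (nfst v))) (npair (nsnd (nfst v)) (nsnd v)))).
  by computable_tac.
have [t1 ht1] := eval_table (CComp chom (CComp cnum ca)) (CComp cN (CComp CFst CFst)).
have [t2 ht2] := eval_table t1 (CComp cM CFst).
have [t3 ht3] := eval_table t2 cN.
have [t4 ht4] := eval_table cmu cM.
exists (CPair cN (CPair cM (CPair t3 (CPair ci t4)))) => x dx.
have [[injS injH ltS ltH] [hok hSp hjunk [hi0 hm hm0]]] := hx x dx.
set n := N (enc x); set m := M (enc x).
pose fS s : 'I_n := Ordinal (ltS s); pose fH h : 'I_m := Ordinal (ltH h).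
have hsp (i : 'I_n) (j : 'I_m) (k : 'I_n) : exists sp : spec (H x),
    [/\ spec_ok sp, num (npair (enc x) (npair i (npair j k))) = spec_code m (@eH x) sp,
      forall s h s', i = fS s -> j = fH h -> k = fS s' -> sp = Sp x s h s' &
      forall w, spec_lang sp w -> exists s', k = fS s'].
  case: (hjunk i j k) => [[s [h [s' [e1 e2 e3]]]]|[sp [ok hsp] e]].
    exists (Sp x s h s'); split=> //; first by rewrite e1 e2 e3 hSp.
      move=> s1 h1 s1' e1' e2' e3'; congr (Sp x _ _ _).
      - by apply: injS; rewrite -e1 e1'.
      - by apply: injH; rewrite -e2 e2'.
      - by apply: injS; rewrite -e3 e3'.
    by move=> _ _; exists s'; apply: val_inj.
  (* The two alternatives of the hypothesis need not exclude each other: a triple that numbers a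
     context keeps the specification of that context. *)
  case: (classic (exists s h s', [/\ i = fS s, j = fH h & k = fS s'])).
    move=> [s [h [s' [-> -> ->]]]]; exists (Sp x s h s'); split=> //.
    - exact: hSp.
    - move=> s1 h1 s1' e1 e2 e3; congr (Sp x _ _ _).
      + by apply: injS; have /(congr1 val) := e1.
      + by apply: injH; have /(congr1 val) := e2.
      + by apply: injS; have /(congr1 val) := e3.
    - by move=> _ _; exists s'.
  move=> hn; exists sp; split=> //; last by move=> w /hsp.
  by move=> s h s' e1 e2 e3; case: hn; exists s, h, s'.
have hr (i : 'I_n) (j : 'I_m) (k : 'I_n) : exists r,
    [/\ eval chom (num (npair (enc x) (npair i (npair j k)))) r, is_rep C m r,
      forall s h s' w, i = fS s -> j = fH h -> k = fS s' ->
        (lang C r w <-> exists2 u, spec_lang (Sp x s h s') u & w = map fH u) &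
      forall w : seq 'I_m, lang C r w -> exists s', k = fS s'].
  have [sp [ok e hs hk]] := hsp i j k.
  have [r [he hrep hl]] := hhom _ m _ (fun y => map fH (spec_hom sp y)) ok.
  have hl' w : lang C r w <-> exists2 u, spec_lang sp u & w = map fH u.
    rewrite hl; split.
      move=> [u hu ->]; exists (flatten (map (spec_hom sp) u)); first by exists u.
      by rewrite flatten_map_map.
    by move=> [_ [u hu ->] ->]; exists u => //; rewrite flatten_map_map.
  exists r; split=> //.
  - move: he; rewrite e /spec_code /enc_hom.
    suff -> : enc_fun (@enc_word m) (fun y => map fH (spec_hom sp y)) =
              enc_fun (enc_seq (@eH x)) (spec_hom sp) by [].
    rewrite /enc_fun; apply: eq_enc_seq => y; rewrite /enc_word enc_seq_map.
    by apply: eq_enc_seq.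
  - by move=> s h s' w e1 e2 e3; rewrite hl' (hs s h s').
  - by move=> w hw; have [u /hk] := (hl' w).1 hw.
have [rep hrep] : exists rep : 'I_n -> 'I_m -> 'I_n -> nat,
  forall (i : 'I_n) (j : 'I_m) (k : 'I_n),
    [/\ eval chom (num (npair (enc x) (npair i (npair j k)))) (rep i j k),
      is_rep C m (rep i j k),
      forall s h s' w, i = fS s -> j = fH h -> k = fS s' ->
        (lang C (rep i j k) w <-> exists2 u, spec_lang (Sp x s h s') u & w = map fH u) &
      forall w : seq 'I_m, lang C (rep i j k) w -> exists s', k = fS s'].
  have [f hf] := fin_all_exists (fun v : 'I_n * 'I_m * 'I_n => hr v.1.1 v.1.2 v.2).
  by exists (fun i j k => f (i, j, k)) => i j k; apply: (hf (i, j, k)).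
exists (AsyncProg rep (fS (s0 x)) [ffun j : 'I_m => mu (enc x) j]); split.
- by move=> i j k; have [] := hrep i j k.
- eexists _, _; split; [exact: hN| |reflexivity].
  eexists _, _; split; [exact: hM| |reflexivity].
  eexists _, _; split; last reflexivity.
    apply: ht3 => // i; apply: ht2 => [|j].
      by exists (enc x) => //=; rewrite npairK.
    apply: ht1 => [|k].
      by exists (enc x) => //=; exists (npair (enc x) i); rewrite /= !npairK.
    have [he _ _ _] := hrep i j k.
    exists (num (npair (enc x) (npair i (npair j k)))) => //.
    exists (npair (enc x) (npair i (npair j k))) => //.
    by have := ha (npair (npair (npair (enc x) i) j) k); rewrite !npairK.
  eexists _, _; split; [exact: hi| |by rewrite hi0].
  apply: ht4 => // j /=; rewrite ffunE.
  by have := hmu (npair (enc x) j); rewrite !npairK.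
exists fS, fH; split=> //=.
- split.
  + by move=> s s' /(congr1 val) /injS.
  + by move=> h h' /(congr1 val) /injH.
  + move=> s h s' w hw; have [_ _ hl _] := hrep (fS s) (fH h) (fS s').
    by apply/(hl s h s' (map fH w)) => //; exists w.
  move=> s h k w2 hw2; have [_ _ hl hk] := hrep (fS s) (fH h) k.
  have [s' e] := hk _ hw2.
  by have /(_ s h s' w2 erefl erefl e) [/(_ hw2) [w hw ->] _] := hl; exists s', w.
- split=> [h|j]; rewrite ffunE; first exact: hm.
  by move=> /hm0 [h e]; exists h; apply: val_inj.
Qed.

End Compilation.

(** * Languages available in every nontrivial full trio *)

(** Erasing all letters of a nonempty language leaves the empty word alone; its preimage under the
    erasing map of a one-letter alphabet is the set of all words. Two automata then cut out a single
    word and the empty language. *)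
Lemma base_languages C : full_trio C ->
  (exists k r (w : seq 'I_k), is_rep C k r /\ lang C r w) ->
  exists r1 rE, [/\ is_rep C 1 r1, is_rep C 1 rE,
    forall w : seq 'I_1, lang C r1 w <-> w = [:: ord0] &
    forall w : seq 'I_1, ~ lang C rE w].
Proof.
move=> [[ci hi] [ch hh] [cp hp]] [k [r [w0 [ok hw0]]]].
have [r2 [_ ok2 h2]] := hh k 1 r (fun=> [::]) ok.
have [r3 [_ ok3 h3]] := hp 1 1 r2 (fun=> [::]) ok2.
have h3' (w : seq 'I_1) : lang C r3 w.
  apply/h3/h2; exists w0 => //; rewrite /hom.
  by elim: (w0) => //=; elim: (w).
have [r1 [_ ok1 h1]] := hi 1 r3 (@Nfa 1 [:: 0] [:: 1] [:: (0, ord0, 1)]) ok3.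
have [rE [_ okE hE]] := hi 1 r3 (@Nfa 1 [::] [::] [::]) ok3.
exists r1, rE; split=> // w; last by move=> /hE [_ [q]]; rewrite in_nil.
rewrite h1; split=> [[_ [q]]|->]; last first.
  by split=> //; exists 0 => //=; exists 1; rewrite ?mem_seq1.
rewrite mem_seq1 => /eqP ->; case: w => [|x w] //=.
move=> [q']; rewrite mem_seq1 => /eqP [-> ->]; case: w => [|y w] //=.
by move=> [q'' ]; rewrite mem_seq1 => /eqP [].
Qed.

Section Words.
Variables (C : lang_class) (r1 rE : nat).
Hypotheses (ok1 : is_rep C 1 r1) (okE : is_rep C 1 rE).
Hypothesis hr1 : forall w : seq 'I_1, lang C r1 w <-> w = [:: ord0].
Hypothesis hrE : forall w : seq 'I_1, ~ lang C rE w.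

Definition sp_empty (H : Type) : spec H := @Spec H 1 rE (fun=> [::]).
(** A context enabled only under [b], which posts exactly [w]: the only letter of the one-word
    language is mapped to [w]. *)
Definition sp_guard (H : Type) (b : bool) (w : seq H) : spec H :=
  if b then @Spec H 1 r1 (fun=> w) else sp_empty H.

Lemma sp_empty_ok H : spec_ok C (sp_empty H). Proof. exact: okE. Qed.

Lemma sp_guard_ok H b w : spec_ok C (@sp_guard H b w).
Proof. by case: b; [exact: ok1|exact: okE]. Qed.

Lemma sp_emptyE H w : ~ spec_lang C (sp_empty H) w.
Proof. by move=> [u /hrE]. Qed.

Lemma sp_guardE H b w u : spec_lang C (@sp_guard H b w) u <-> b /\ u = w.
Proof.
case: b; last by split=> [/sp_emptyE|[]].
split=> [[v /hr1 -> ->]|[_ ->]]; first by rewrite /= cats0.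
by exists [:: ord0]; [apply/hr1|rewrite /= cats0].
Qed.

(** [(npair 0 0).+1] is the table of the homomorphism that sends the only letter to the empty
    word. *)
Definition code_empty (n : nat) : nat := npair 1 (npair n (npair rE (npair 0 0).+1)).
Definition code_guard (n : nat) (b : bool) (w : nat) : nat :=
  if b then npair 1 (npair n (npair r1 (npair w 0).+1)) else code_empty n.

Lemma sp_empty_code H n eH : spec_code n eH (sp_empty H) = code_empty n.
Proof. by rewrite /spec_code /= (enc_funE (g := fun=> 0)). Qed.

Lemma sp_guard_code H n eH b w :
  spec_code n eH (@sp_guard H b w) = code_guard n b (enc_seq eH w).
Proof.
case: b; last exact: sp_empty_code.
by rewrite /spec_code /= (enc_funE (g := fun=> enc_seq eH w)).
Qed.

End Words.

Arguments sp_guard : simpl never.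
Arguments code_guard : simpl never.

(** * Context languages of the given program, and access to its encoding *)

Section Contexts.
Variables (C : lang_class) (P : async_prog).

Definition sp_ctx (H : Type) d s d' (f : 'I_(handlers P) -> H) : spec H :=
  @Spec H (handlers P) (ctx_rep P d s d') (fun x => [:: f x]).

Lemma sp_ctxE H d s d' (f : 'I_(handlers P) -> H) w :
  spec_lang C (sp_ctx d s d' f) w <->
  exists2 u, prog_lang C d s d' u & w = map f u.
Proof.
by split=> -[u hu ->]; exists u; rewrite //= ?flatten_map1 // -flatten_map1.
Qed.

End Contexts.

Definition nstates (x : nat) : nat := nfst x.
Definition nhandlers (x : nat) : nat := nfst (nsnd x).
Definition nrep (x d s d' : nat) : nat :=
  dnth (dnth (dnth (nfst (nsnd (nsnd x))) d) s) d'.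
Definition nstate0 (x : nat) : nat := nfst (nsnd (nsnd (nsnd x))).
Definition nmset0 (x s : nat) : nat := dnth (nsnd (nsnd (nsnd (nsnd x)))) s.

Lemma nstatesE P : nstates (enc_prog P) = states P.
Proof. by rewrite /nstates /enc_prog !npairK. Qed.
Lemma nhandlersE P : nhandlers (enc_prog P) = handlers P.
Proof. by rewrite /nhandlers /enc_prog !npairK. Qed.
Lemma nrepE P (d : 'I_(states P)) (s : 'I_(handlers P)) (d' : 'I_(states P)) :
  nrep (enc_prog P) d s d' = ctx_rep P d s d'.
Proof. by rewrite /nrep /enc_prog !npairK !dnth_enc_fun. Qed.
Lemma nstate0E P : nstate0 (enc_prog P) = state0 P.
Proof. by rewrite /nstate0 /enc_prog !npairK. Qed.
Lemma nmset0E P (s : 'I_(handlers P)) : nmset0 (enc_prog P) s = mset0 P s.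
Proof. by rewrite /nmset0 /enc_prog !npairK dnth_enc_fun. Qed.

(** A context language with every handler renamed to its copy of the given tag;
    [(npair (npair tag i) 0).+1] codes a one-letter word. *)
Definition code_ctx (n x d s d' tag : nat) : nat :=
  npair (nhandlers x) (npair n (npair (nrep x d s d')
    (enc_seq (fun i => (npair (npair tag i) 0).+1) (iota 0 (nhandlers x))))).

Lemma sp_ctx_code P H n (eH : H -> nat) d s d' tag (f : 'I_(handlers P) -> H) :
  (forall x, eH (f x) = npair tag x) ->
  spec_code n eH (sp_ctx d s d' f) = code_ctx n (enc_prog P) d s d' tag.
Proof.
move=> hf; rewrite /spec_code /code_ctx nhandlersE nrepE /=; do 3 congr npair.
by apply: enc_funE => i /=; rewrite hf.
Qed.

(* Z is the control handler and T1 x the handler x of the simulated program; the role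
   of the other copies of x depends on the construction. *)
Inductive coloured (n : nat) : Type :=
| Z | T1 of 'I_n | T2 of 'I_n | T3 of 'I_n | Tg of 'I_n | Tb of 'I_n.
Arguments Z {n}.

Definition coloured_code n (h : coloured n) : nat :=
  match h with
  | Z => npair 0 0 | T1 s => npair 1 s | T2 s => npair 2 s
  | T3 s => npair 3 s | Tg s => npair 4 s | Tb s => npair 5 s
  end.

Lemma coloured_code_inj n : injective (@coloured_code n).
Proof.
by case=> [|s|s|s|s|s] [|t|t|t|t|t] //= /npair_inj [] // _ /val_inj ->.
Qed.

HB.instance Definition _ n :=
  hasDecEq.Build (coloured n) (inj_eqAxiom (@coloured_code_inj n)).

Lemma coloured_eqE n (a b : coloured n) : (a == b) =
  match a, b with
  | Z, Z => true
  | T1 s, T1 t | T2 s, T2 t | T3 s, T3 t | Tg s, Tg t | Tb s, Tb t => s == t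
  | _, _ => false
  end.
Proof.
have -> : (a == b) = (coloured_code a == coloured_code b) by [].
by case: a b => [|s|s|s|s|s] [|t|t|t|t|t] //=; rewrite npair_eq.
Qed.

Definition coloured_valid (n j : nat) : bool :=
  (j == npair 0 0) || (0 < nfst j) && (nfst j <= 5) && (nsnd j < n).

Lemma coloured_validP n j :
  coloured_valid n j -> exists h : coloured n, j = coloured_code h.
Proof.
move=> /orP [/eqP ->|/andP [/andP [h1 h2] h3]]; first by exists Z.
rewrite -[j]npair_nfst_nsnd; move: h1 h2 h3.
case: (nfst j) => [|[|[|[|[|[|k]]]]]] // _ _ hs.
- by exists (T1 (Ordinal hs)).
- by exists (T2 (Ordinal hs)).
- by exists (T3 (Ordinal hs)).
- by exists (Tg (Ordinal hs)).
- by exists (Tb (Ordinal hs)).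
Qed.

Lemma coloured_code_valid n (h : coloured n) : coloured_valid n (coloured_code h).
Proof.
by rewrite /coloured_valid; case: h => [|s|s|s|s|s] /=;
  rewrite ?eqxx ?npairK ?ltn_ord ?orbT.
Qed.

(** A strict bound on the codes, 5 being the largest tag; not every index below it codes a
    handler. *)
Definition ncoloured n := (npair 5 n).+1.

Lemma coloured_code_bound n (h : coloured n) : coloured_code h < ncoloured n.
Proof.
by case: h => [|s|s|s|s|s]; rewrite ltnS; apply: leq_npair => //=; apply: ltnW.
Qed.

Lemma count_map_inj (T U : eqType) (f : T -> U) (u : seq T) x :
  injective f -> count_mem (f x) (map f u) = count_mem x u.
Proof. by move=> hf; rewrite count_map; apply: eq_count => y /=; rewrite (inj_eq hf). Qed.

Lemma count_map_disjoint (T U : eqType) (f : T -> U) (u : seq T) y :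
  (forall x, f x != y) -> count_mem y (map f u) = 0.
Proof.
by move=> hf; apply/count_memPn/mapP => -[x _ e]; have := hf x; rewrite -e eqxx.
Qed.

(** * Steps without subtraction, and reachability *)

Section FireLemmas.
Variables (S : Type) (H : eqType) (L : S -> H -> S -> seq H -> Prop).

(** The consumed instance moves to the other side of the equation, which avoids truncated
    subtraction. *)
Lemma fireE s m h s' m' : fire L s m h s' m' <->
  0 < m h /\ exists2 w, L s h s' w & forall x, m' x + (h == x) = m x + count_mem x w.
Proof.
split=> -[h0 [w hw e]]; split=> //; exists w => // x; have := e x;
  by rewrite (eq_sym h); case: eqP => [->|_]; lia.
Qed.

Definition star s m s' m' := exists tr, exec L s m tr s' m'.

Lemma star_refl s m m' : m =1 m' -> star s m s m'.
Proof. by exists [::]. Qed.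

Lemma star_trans s1 m1 s2 m2 s3 m3 :
  star s1 m1 s2 m2 -> star s2 m2 s3 m3 -> star s1 m1 s3 m3.
Proof. by move=> [t h] [t' h']; exists (t ++ t'); apply: exec_cat h h'. Qed.

Lemma star_fire s m h s' m' w s2 m2 : L s h s' w -> 0 < m h ->
  (forall x, m' x + (h == x) = m x + count_mem x w) ->
  star s' m' s2 m2 -> star s m s2 m2.
Proof.
move=> hw h0 e; apply: star_trans; exists [:: h]; apply: exec_fire.
by apply/fireE; split=> //; exists w.
Qed.

End FireLemmas.

Lemma consumeK (T : eqType) (m : T -> nat) x y :
  0 < m x -> m y - (y == x) + (x == y) = m y.
Proof. by rewrite (eq_sym x) => h; case: eqP => [->|_]; lia. Qed.

(** The termination measure of the phases that remove handlers one at a time. *)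
Lemma sum_decr (T : finType) (m : T -> nat) t : 0 < m t ->
  \sum_x (m x - (x == t)) < \sum_x m x.
Proof.
move=> h; rewrite (bigD1 t) //= [X in _ < X](bigD1 t) //= eqxx.
suff -> : \sum_(i | i != t) (m i - (i == t)) = \sum_(i | i != t) m i by lia.
by apply: eq_bigr => i /negbTE ->; rewrite subn0.
Qed.

(** * From reachability to fair runs *)

Inductive bstate (D n : nat) : Type := BRun of 'I_D | BTest | BMatch of 'I_n.
Arguments BTest {D n}.
Arguments BRun {D n}.
Arguments BMatch {D n}.

Section ReachToFair.
Variables (C : lang_class) (r1 rE : nat).
Hypothesis ok1 : is_rep C 1 r1.
Hypothesis okE : is_rep C 1 rE.
Hypothesis hr1 : forall w : seq 'I_1, lang C r1 w <-> w = [:: ord0].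
Hypothesis hrE : forall w : seq 'I_1, ~ lang C rE w.

(* BRun d simulates the program in state d; BTest cancels T2 x against T1 x through
   BMatch x.  The handlers T2 x initially hold the target multiset. *)
Variable P : async_prog.
Variable dt : 'I_(states P).
Variable mt : 'I_(handlers P) -> nat.
Local Notation n := (handlers P).
Local Notation PL := (prog_lang C (P := P)).

Definition bspec (s : bstate (states P) n) (h : coloured n)
    (s' : bstate (states P) n) : spec (coloured n) :=
  match s, h, s' with
  | BRun d, T1 x, BRun d' => sp_ctx d x d' (@T1 n)
  | BRun d, Z, BTest => sp_guard r1 rE (d == dt) [:: Z]
  | BTest, Z, BTest => sp_guard r1 rE true [:: Z]
  | BTest, T2 x, BMatch y => sp_guard r1 rE (x == y) [::]
  | BMatch x, T1 y, BTest => sp_guard r1 rE (x == y) [::]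
  | _, _, _ => sp_empty rE _
  end.

Definition bcount (z : nat) (m1 m2 : 'I_n -> nat) (h : coloured n) : nat :=
  match h with Z => z | T1 x => m1 x | T2 x => m2 x | _ => 0 end.

Local Notation L := (system C bspec).

Lemma bspec_ok s h s' : prog_over C P -> spec_ok C (bspec s h s').
Proof.
move=> hP; case: s h s' => [d||x] [|y|y|y|y|y] [d'||x'] /=;
  by first [exact: sp_empty_ok okE _|exact: sp_guard_ok
           |rewrite /spec_ok /=; apply: hP].
Qed.

Let T1_inj : injective (@T1 n). Proof. by move=> x y []. Qed.

Lemma brun_exec d m tr d' m' z m2 : exec PL d m tr d' m' ->
  star L (BRun d) (bcount z m m2) (BRun d') (bcount z m' m2).
Proof.
elim: tr d m => [|x tr ih] d m /=.
  by move=> [-> e]; apply: star_refl; case=> //= y.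
move=> [d1 [m1 [/fireE [h0 [w hw e]] /ih]]].
apply: (star_fire (h := T1 x) (s' := BRun d1) (w := map (@T1 n) w)) => //.
  by apply/sp_ctxE; exists w.
case=> [|y|y|y|y|y]; rewrite coloured_eqE /= ?count_map_inj //;
  by rewrite count_map_disjoint => // ?; rewrite coloured_eqE.
Qed.

(** One round through [BMatch x] removes one [T2 x] and one [T1 x]; the induction is on the number
    of rounds. *)
Lemma btest_match k z m : \sum_x m x <= k ->
  star L BTest (bcount z m m) BTest (bcount z (fun=> 0) (fun=> 0)).
Proof.
elim: k m => [|k ih] m hm.
  apply: star_refl; case=> //= x; apply/eqP; rewrite -leqn0;
  by apply: leq_trans hm; rewrite (bigD1 x) //= leq_addr.
case: (classic (exists x, 0 < m x)) => [[x hx]|hn]; last first.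
  by apply: star_refl; case=> //= x; case: (posnP (m x)) => // hx; case: hn; exists x.
pose mx y := m y - (y == x).
apply: (star_fire (h := T2 x) (s' := BMatch x) (m' := bcount z m mx) (w := [::])) => //.
  by apply/sp_guardE.
  by case=> [|y|y|y|y|y]; rewrite coloured_eqE //= /mx addn0 consumeK.
apply: (star_fire (h := T1 x) (s' := BTest) (m' := bcount z mx mx) (w := [::])) => //.
  by apply/sp_guardE.
  by case=> [|y|y|y|y|y]; rewrite coloured_eqE //= /mx addn0 consumeK.
by apply: ih; rewrite -ltnS; apply: leq_trans (sum_decr hx) hm.
Qed.

Lemma reach_lasso fl s0 m0 : (exists tr, exec PL s0 m0 tr dt mt) ->
  lasso L fl (BRun s0) (bcount 2 m0 mt).
Proof.
move=> [tr htr].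
(* The loop executes [Z], which reposts itself. For starvation one of the two instances of [Z] is
   set aside, otherwise both stay in the loop. *)
pose k := if fl then 1 else 2.
have [tr1 h1] : star L (BRun s0) (bcount 2 m0 mt) BTest
    (bcount 2 (fun=> 0) (fun=> 0)).
  apply: star_trans (brun_exec _ _ htr) _.
  apply: (star_fire (h := Z) (s' := BTest) (m' := bcount 2 mt mt) (w := [:: Z])) => //.
  - by apply/sp_guardE.
  - by case=> [|y|y|y|y|y]; rewrite coloured_eqE /= coloured_eqE //= addn0.
  exact: btest_match (leqnn _).
exists BTest, (bcount k (fun=> 0) (fun=> 0)), (bcount (2 - k) (fun=> 0) (fun=> 0)).
exists (bcount k (fun=> 0) (fun=> 0)), tr1, [:: Z]; split=> //.
- by apply: exec_ext h1 => // -[] //=; rewrite /k; case: (fl).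
- apply: exec_fire; apply/fireE; split; first by rewrite /k /=; case: (fl).
  exists [:: Z]; first by apply/sp_guardE.
  by case=> [|y|y|y|y|y]; rewrite coloured_eqE /= coloured_eqE //= addn0.
split=> [[|x|x|x|x|x]|]; try by right.
  by left; rewrite mem_head.
rewrite /k; case: (fl) => /=; last by case.
by exists Z => -[|x|x|x|x|x]; rewrite coloured_eqE.
Qed.

Definition bafter (s : bstate (states P) n) : bool := if s is BRun _ then false else true.

(** After the simulation only [Z] is ever posted, so every other count drops by the number of its
    executions. *)
Lemma bafter_exec s m tr s' m' : exec L s m tr s' m' -> bafter s ->
  bafter s' /\ forall h, h != Z -> m' h + count_mem h tr = m h.
Proof.
elim: tr s m => [|h tr ih] s m /=.
  by move=> [<- e] hs; split=> // h _; rewrite e addn0.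
move=> [s1 [m1 [/fireE [h0 [w hw e]] h2]]] hs.
have [hs1 hw0] : bafter s1 /\ forall x, x != Z -> count_mem x w = 0.
  case: s h s1 hs hw {h0 e h2} => [d||x] [|y|y|y|y|y] [d'||x'] //= _;
    try by move=> /sp_emptyE.
  - move=> /sp_guardE [] // _ ->; split=> // a /negbTE.
    by rewrite eq_sym /= => ->.
  - by move=> /sp_guardE [] // _ ->.
  - by move=> /sp_guardE [] // _ ->.
have [hs' e'] := ih _ _ h2 hs1; split=> // x hx.
by move: (e x) (e' x hx); rewrite hw0 //=; lia.
Qed.

(** Executing [Z] ends the simulation, and no transition leads back to it. *)
Lemma brun_noZ d m tr d' m' : exec L (BRun d) m tr (BRun d') m' -> Z \notin tr.
Proof.
elim: tr d m => [|h tr ih] d m //= [s1 [m1 [/fireE [_ [w hw _]] h2]]].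
case: s1 hw h2 => [d1||x] hw h2.
- rewrite inE negb_or (ih _ _ h2) andbT coloured_eqE.
  by case: h hw => //= /sp_emptyE.
- by have [] := bafter_exec h2.
- by have [] := bafter_exec h2.
Qed.

(** Here [c] is the multiset with which the simulation ended; cancellation preserves the difference
    between the [T1] and the [T2] counts. *)
Lemma binvariant s0 m0 tr s m : exec L (BRun s0) (bcount 2 m0 mt) tr s m ->
  match s with
  | BRun d => [/\ m Z = 2, exists t, exec PL s0 m0 t d (fun x => m (T1 x)) &
                 forall x, m (T2 x) = mt x]
  | BTest => exists2 c, exists t, exec PL s0 m0 t dt c &
               forall x, m (T1 x) + mt x = c x + m (T2 x)
  | BMatch _ => True
  end.
Proof.
(* The induction also needs the state between the two halves of a cancellation, where [T2 y] is gone
   and [T1 y] is not yet. *)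
pose I s (m : coloured n -> nat) := match s with
  | BRun d => [/\ m Z = 2, exists t, exec PL s0 m0 t d (fun x => m (T1 x)) &
                 forall x, m (T2 x) = mt x]
  | BTest => exists2 c, exists t, exec PL s0 m0 t dt c &
               forall x, m (T1 x) + mt x = c x + m (T2 x)
  | BMatch y => exists2 c, exists t, exec PL s0 m0 t dt c &
               forall x, m (T1 x) + mt x = c x + m (T2 x) + (y == x)
  end.
suff H : exec L (BRun s0) (bcount 2 m0 mt) tr s m -> I s m.
  by move=> /H; case: (s).
apply: (exec_inv (I := fun s m _ => I s m)) => {tr s m}.
  move=> m e; split=> [||x]; rewrite -?e //.
  by exists [::]; split=> // x; rewrite -e.
move=> s1 m1 _ h s2 m2 + /fireE [h0 [w hw e]].
case: s1 h s2 hw e h0 => [d||x] [|y|y|y|y|y] [d'||x'] //= hw e h0;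
  try (by case: (sp_emptyE hrE hw)).
- move: hw => /(sp_guardE hr1 hrE) [/eqP <- ew] [_ [t ht] h2].
  exists (fun x => m1 (T1 x)) => [|x]; first by exists t.
  move: (e (T1 x)) (e (T2 x)) (h2 x).
  by rewrite ew /= !coloured_eqE; lia.
- move: hw => /sp_ctxE [u hu ew] [hZ [t ht] h2]; split=> [||x].
  + move: (e Z).
    rewrite ew count_map_disjoint; last by move=> ?; rewrite coloured_eqE.
    by rewrite coloured_eqE; lia.
  + exists (t ++ [:: y]); apply: exec_cat ht (exec_fire _).
    apply/fireE; split=> //; exists u => // x.
    by have := e (T1 x); rewrite ew count_map_inj // coloured_eqE.
  + move: (e (T2 x)) (h2 x).
    rewrite ew count_map_disjoint; last by move=> ?; rewrite coloured_eqE.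
    by rewrite coloured_eqE; lia.
- move: hw => /(sp_guardE hr1 hrE) [_ ew] [c hc h2]; exists c => // x.
  move: (e (T1 x)) (e (T2 x)) (h2 x).
  by rewrite ew /= !coloured_eqE; lia.
- move: hw => /(sp_guardE hr1 hrE) [/eqP <- ew] [c hc h2]; exists c => // x.
  move: (e (T1 x)) (e (T2 x)) (h2 x).
  by rewrite ew /= !coloured_eqE; lia.
- move: hw => /(sp_guardE hr1 hrE) [/eqP exy ew].
  rewrite -exy in e; move=> [c hc h2]; exists c => // z.
  move: (e (T1 z)) (e (T2 z)) (h2 z).
  by rewrite ew /= !coloured_eqE; lia.
Qed.

(** A loop inside the simulation would have to execute the pending [Z], which ends the simulation. A
    loop from [BMatch] first consumes a [T1] that is never posted again. In a loop from [BTest], a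
    pending handler other than [Z] would have to be executed and thus decrease for good; so none is
    left and the cancellation was exact. *)
Lemma lasso_reach s0 m0 : lasso L false (BRun s0) (bcount 2 m0 mt) ->
  exists tr, exec PL s0 m0 tr dt mt.
Proof.
move=> [s [m [b [m' [tr1 [tr2 [h1 h2 hle hne [hin hb]]]]]]]].
have {}h1 : exec L (BRun s0) (bcount 2 m0 mt) tr1 s m.
  by apply: exec_ext h1 => // x; rewrite hb addn0.
have inv1 := binvariant h1; have inv2 := binvariant (exec_cat h1 h2).
case: s h1 h2 inv1 inv2 => [d||x] h1 h2 inv1 inv2.
- case: inv2 => hZ _ _; case: (hin Z) => [hz|]; last by rewrite hZ.
  by have := brun_noZ h2; rewrite hz.
- have [_ hT] := bafter_exec h2 isT.
  have m0' h : h != Z -> m h = 0.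
    move=> hz; case: (hin h) => [|hm]; last by have := hle h; lia.
    by rewrite -has_pred1 has_count; have := hT h hz; have := hle h; lia.
  case: inv1 => c [t ht] hc; exists t; apply: exec_ext ht => // y.
  by have := hc y; rewrite !m0' ?coloured_eqE //; lia.
- have [_ hT] := bafter_exec h2 isT.
  case: tr2 h2 hne {hin} hT => // h tr /= [s1 [m1 [/fireE [_ [w hw _]] _]]] _.
  case: h s1 hw => [|y|y|y|y|y] [d'||x'] //= hw; try (by case: (sp_emptyE hrE hw)).
  by move=> /(_ (T1 y)); have := hle (T1 y); rewrite coloured_eqE eqxx; lia.
Qed.

End ReachToFair.

(** * From lassos to reachability *)

Inductive astate (D n : nat) : Type :=
| ARun of 'I_D | AFreeze of 'I_D | ACopy of 'I_D | ALoop of 'I_D & 'I_D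
| AMark of 'I_D & 'I_D & 'I_n | ACheck of 'I_n | AMatch of 'I_n | ADone.
Arguments ARun {D n}.
Arguments AFreeze {D n}.
Arguments ACopy {D n}.
Arguments ALoop {D n}.
Arguments AMark {D n}.
Arguments ACheck {D n}.
Arguments AMatch {D n}.
Arguments ADone {D n}.

Section LassoToReach.
Variables (C : lang_class) (r1 rE : nat).
Hypothesis ok1 : is_rep C 1 r1.
Hypothesis okE : is_rep C 1 rE.
Hypothesis hr1 : forall w : seq 'I_1, lang C r1 w <-> w = [:: ord0].
Hypothesis hrE : forall w : seq 'I_1, ~ lang C rE w.

(* ARun d simulates the program; AFreeze sets one instance aside as Tb x; ACopy turns
   each T1 x into T2 x and a copy T3 x; ALoop e d simulates on T2 a loop started in e,
   and AMark records each executed x as Tg x; ACheck x, entered through Tg x, discards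
   T2 x and Tb x, and cancels T3 x against T2 x through AMatch x. *)
Variable fl : bool.
Variable P : async_prog.
Local Notation n := (handlers P).
Local Notation PL := (prog_lang C (P := P)).
Local Notation guard := (sp_guard r1 rE).

Definition aspec (s : astate (states P) n) (h : coloured n)
    (s' : astate (states P) n) : spec (coloured n) :=
  match s, h, s' with
  | ARun d, T1 x, ARun d' => sp_ctx d x d' (@T1 n)
  | ARun d, Z, AFreeze d' => guard (fl && (d == d')) [:: Z]
  | ARun d, Z, ACopy d' => guard (~~ fl && (d == d')) [:: Z]
  | AFreeze d, T1 x, ACopy d' => guard (d == d') [:: Tb x]
  | ACopy d, T1 x, ACopy d' => guard (d == d') [:: T2 x; T3 x]
  | ACopy d, Z, ALoop e d' => guard ((d == e) && (d == d')) [:: Z]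
  | ALoop e d, T2 x, AMark e' d' y =>
      if (e == e') && (x == y) then sp_ctx d x d' (@T2 n) else sp_empty rE _
  | AMark e d x, Z, ALoop e' d' => guard ((e == e') && (d == d')) [:: Z; Tg x]
  | ALoop e d, Tg x, ACheck y => guard ((e == d) && (x == y)) [::]
  | ACheck x, T2 y, ACheck z => guard ((x == y) && (x == z)) [::]
  | ACheck x, Tb y, ACheck z => guard ((x == y) && (x == z)) [::]
  | ACheck x, T3 y, AMatch z => guard ((x == y) && (x == z)) [::]
  | AMatch x, T2 y, ACheck z => guard ((x == y) && (x == z)) [::]
  | ACheck x, Tg y, ACheck z => guard (y == z) [::]
  | ACheck x, Z, ADone => guard true [::]
  | _, _, _ => sp_empty rE _
  end.

Definition acount (z : nat) (m1 m2 m3 g b : 'I_n -> nat) (h : coloured n) : nat :=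
  match h with
  | Z => z | T1 x => m1 x | T2 x => m2 x | T3 x => m3 x | Tg x => g x | Tb x => b x
  end.

Local Notation L := (system C aspec).
Local Notation zero := (fun=> 0).

Lemma aspec_ok s h s' : prog_over C P -> spec_ok C (aspec s h s').
Proof.
move=> hP; case: s h s' => [d|d|d|e d|e d x|x|x|] [|y|y|y|y|y]
  [d'|d'|d'|e' d'|e' d' x'|x'|x'|] /=; try case: ifP => _;
  by first [exact: sp_empty_ok okE _|exact: sp_guard_ok|exact: ok1
           |rewrite /spec_ok /=; apply: hP].
Qed.

Let T1_inj : injective (@T1 n). Proof. by move=> x y []. Qed.
Let T2_inj : injective (@T2 n). Proof. by move=> x y []. Qed.

Lemma arun_exec d m tr d' m' z m2 m3 g b : exec PL d m tr d' m' ->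
  star L (ARun d) (acount z m m2 m3 g b) (ARun d') (acount z m' m2 m3 g b).
Proof.
elim: tr d m => [|x tr ih] d m /=.
  by move=> [-> e]; apply: star_refl; case=> //= y.
move=> [d1 [m1 [/fireE [h0 [w hw e]] /ih]]].
apply: (star_fire (h := T1 x) (s' := ARun d1) (w := map (@T1 n) w)) => //.
  by apply/sp_ctxE; exists w.
case=> [|y|y|y|y|y]; rewrite coloured_eqE /= ?count_map_inj //;
  by rewrite count_map_disjoint => // ?; rewrite coloured_eqE.
Qed.

(** One simulated step takes two: [T2 x] is executed, then [Z] posts the mark. So [Tg x] counts the
    executions of [x]. *)
Lemma aloop_exec e d m tr d' m' m3 g b : exec PL d m tr d' m' ->
  star L (ALoop e d) (acount 1 zero m m3 g b)
    (ALoop e d') (acount 1 zero m' m3 (fun x => g x + count_mem x tr) b).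
Proof.
elim: tr d m g => [|x tr ih] d m g /=.
  by move=> [-> em]; apply: star_refl; case=> //= y; rewrite addn0.
move=> [d1 [m1 [/fireE [h0 [w hw em]] h2]]].
apply: (star_fire (h := T2 x) (s' := AMark e d1 x)
  (m' := acount 1 zero m1 m3 g b) (w := map (@T2 n) w)) => //.
- by rewrite /system /= !eqxx; apply/sp_ctxE; exists w.
- case=> [|y|y|y|y|y]; rewrite coloured_eqE /= ?count_map_inj //;
  by rewrite count_map_disjoint => // ?; rewrite coloured_eqE.
apply: (star_fire (h := Z) (s' := ALoop e d1)
  (m' := acount 1 zero m1 m3 (fun y => g y + (x == y)) b) (w := [:: Z; Tg x])) => //.
- by apply/sp_guardE => //; rewrite !eqxx.
- by case=> [|y|y|y|y|y]; rewrite coloured_eqE /= !coloured_eqE; lia.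
apply: star_trans (ih _ _ _ h2) _; apply: star_refl.
by case=> //= y; rewrite addnA.
Qed.

Lemma acopy_all k d c m b : \sum_x c x <= k ->
  star L (ACopy d) (acount 1 c m m zero b)
    (ACopy d) (acount 1 zero (fun x => m x + c x) (fun x => m x + c x) zero b).
Proof.
elim: k c m => [|k ih] c m hc.
  have c0 x : c x = 0.
    by apply/eqP; rewrite -leqn0; apply: leq_trans hc; rewrite (bigD1 x) //= leq_addr.
  by apply: star_refl; case=> //= x; rewrite c0 // addn0.
case: (classic (exists x, 0 < c x)) => [[x hx]|hn]; last first.
  have c0 x : c x = 0 by case: (posnP (c x)) => // hx; case: hn; exists x.
  by apply: star_refl; case=> //= x; rewrite c0 // addn0.
pose cx y := c y - (y == x); pose mx y := m y + (x == y).
apply: (star_fire (h := T1 x) (s' := ACopy d)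
  (m' := acount 1 cx mx mx zero b) (w := [:: T2 x; T3 x])) => //.
- by apply/sp_guardE.
- by case=> [|y|y|y|y|y]; rewrite coloured_eqE /= !coloured_eqE /cx ?consumeK //
    /mx /= ?addn0 ?add0n.
have hle : \sum_y cx y <= k by rewrite -ltnS; apply: leq_trans (sum_decr hx) hc.
apply: star_trans (ih _ mx hle) _; apply: star_refl.
by case=> //= y; rewrite -addnA [(x == y) + _]addnC consumeK.
Qed.

(** For the current handler, first match all [T3 s], then discard the surplus [T2 s] and [Tb s],
    then move to another handler by consuming a mark. Matching comes first because discarding could
    use up the partners of [T3 s]. The last hypothesis says that every handler with something to
    discard is current or still marked. *)
Lemma acheck_all k s m2 m3 g b : \sum_x (m2 x + g x + b x) < k ->
  (forall x, m3 x <= m2 x) ->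
  (forall x, 0 < m2 x + b x -> x = s \/ 0 < g x) ->
  star L (ACheck s) (acount 1 zero m2 m3 g b) ADone zero.
Proof.
elim: k s m2 m3 g b => // k ih s m2 m3 g b hk hle hg.
have dec (f f' : 'I_n -> nat) x : (forall y, f' y <= f y) -> f' x < f x ->
    \sum_y f y < k.+1 -> \sum_y f' y < k.
  move=> h1 h2 h3; rewrite -ltnS; apply: leq_ltn_trans h3.
  rewrite (bigD1 x) //= [X in _ < X](bigD1 x) //= -addSn.
  by apply: leq_add => //; apply: leq_sum.
case: (posnP (m3 s)) => [m3s|m3s]; last first.
  have m2s := leq_trans m3s (hle s).
  apply: (star_fire (h := T3 s) (s' := AMatch s) (w := [::])
    (m' := acount 1 zero m2 (fun y => m3 y - (y == s)) g b)) => //.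
  - by apply/sp_guardE => //; rewrite eqxx.
  - by case=> [|y|y|y|y|y]; rewrite coloured_eqE /= ?addn0 ?consumeK.
  apply: (star_fire (h := T2 s) (s' := ACheck s) (w := [::])
    (m' := acount 1 zero (fun y => m2 y - (y == s)) (fun y => m3 y - (y == s)) g b))
    => //.
  - by apply/sp_guardE => //; rewrite eqxx.
  - by case=> [|y|y|y|y|y]; rewrite coloured_eqE /= ?addn0 ?consumeK.
  apply: ih => [|x|x hx].
  - by apply: (dec _ _ s _ _ hk) => [y|]; rewrite ?eqxx; lia.
  - exact: leq_sub2r.
  - by apply: hg; lia.
case: (posnP (m2 s)) => [m2s|m2s]; last first.
  apply: (star_fire (h := T2 s) (s' := ACheck s) (w := [::])
    (m' := acount 1 zero (fun y => m2 y - (y == s)) m3 g b)) => //.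
  - by apply/sp_guardE => //; rewrite eqxx.
  - by case=> [|y|y|y|y|y]; rewrite coloured_eqE /= ?addn0 ?consumeK.
  apply: ih => [|x|x hx].
  - by apply: (dec _ _ s _ _ hk) => [y|]; rewrite ?eqxx; lia.
  - by case: eqP => [->|_]; [rewrite m3s|rewrite subn0].
  - by apply: hg; lia.
case: (posnP (b s)) => [bs|bs]; last first.
  apply: (star_fire (h := Tb s) (s' := ACheck s) (w := [::])
    (m' := acount 1 zero m2 m3 g (fun y => b y - (y == s)))) => //.
  - by apply/sp_guardE => //; rewrite eqxx.
  - by case=> [|y|y|y|y|y]; rewrite coloured_eqE /= ?addn0 ?consumeK.
  apply: ih => [|x|x hx] //.
  - by apply: (dec _ _ s _ _ hk) => [y|]; rewrite ?eqxx; lia.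
  - by apply: hg; lia.
case: (classic (exists t, 0 < g t)) => [[t gt]|hn].
  apply: (star_fire (h := Tg t) (s' := ACheck t) (w := [::])
    (m' := acount 1 zero m2 m3 (fun y => g y - (y == t)) b)) => //.
  - by apply/sp_guardE.
  - by case=> [|y|y|y|y|y]; rewrite coloured_eqE /= ?addn0 ?consumeK.
  apply: ih => [|x|x hx] //.
  - by apply: (dec _ _ t _ _ hk) => [y|]; rewrite ?eqxx; lia.
  - case: (x =P t) => [->|_]; first by left.
    right; case: (hg x hx) => [e|]; last by rewrite subn0.
    by move: hx; rewrite e m2s bs.
have z x : [/\ m2 x = 0, m3 x = 0, g x = 0 & b x = 0].
  have gx : g x = 0 by case: (posnP (g x)) => // h; case: hn; exists x.
  case: (posnP (m2 x + b x)) => [e|/hg [->|]]; last by rewrite gx.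
    by have := hle x; split=> //; lia.
  by split=> //; rewrite -?[in g s]gx //; case: (posnP (g s)) => // h; case: hn; exists s.
apply: (star_fire (h := Z) (s' := ADone) (m' := zero) (w := [::])) => //.
- by apply/sp_guardE.
- by case=> [|x|x|x|x|x]; rewrite coloured_eqE //=; have [? ? ? ?] := z x; lia.
exact: star_refl.
Qed.

Lemma alasso_reach s0 m0 : lasso PL fl s0 m0 ->
  star L (ARun s0) (acount 1 m0 zero zero zero zero) ADone zero.
Proof.
move=> [d [m [b [m' [tr1 [tr2 [h1 h2 hle hne [hin hb]]]]]]]].
apply: star_trans (arun_exec _ _ _ _ _ h1) _.
(* The two kinds of lasso differ only in how [b] is split off; the rest is common. *)
have H : star L (ACopy d) (acount 1 m zero zero zero b) ADone zero.
  apply: star_trans (acopy_all _ _ _ (leqnn _)) _.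
  apply: (star_fire (h := Z) (s' := ALoop d d) (w := [:: Z])
    (m' := acount 1 zero m m zero b)) => //.
  - by apply/sp_guardE => //; rewrite eqxx.
  - by case=> [|y|y|y|y|y]; rewrite coloured_eqE /= ?coloured_eqE //= ?addn0.
  apply: star_trans (aloop_exec _ _ _ _ h2) _.
  have [s hs] : exists s, s \in tr2.
    by case: (tr2) hne => // x s _; exists x; rewrite mem_head.
  have gs : 0 < count_mem s tr2 by rewrite -has_count has_pred1.
  (* Entering the check consumes one mark of [s], which is no loss since [s] is then the current
     handler. *)
  apply: (star_fire (h := Tg s) (s' := ACheck s) (w := [::])
    (m' := acount 1 zero m' m (fun y => count_mem y tr2 - (y == s)) b)) => //.
  - by apply/sp_guardE => //; rewrite !eqxx.
  - case=> [|y|y|y|y|y]; rewrite coloured_eqE /= ?addn0 //.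
    exact: (consumeK (m := fun y => count_mem y tr2)).
  apply: acheck_all (ltnSn _) hle _ => x hx.
  case: (x =P s) => [->|_]; [by left|right]; rewrite subn0.
  by case: (hin x) => [|e]; [rewrite -has_pred1 has_count|move: hx; rewrite e].
have [[y [hfl hb']]|[hfl hb']] :
    (exists y, fl /\ forall x, b x = (x == y)) \/ (~~ fl /\ forall x, b x = 0).
- by case: (fl) hb => [[y hy]|hb']; [left; exists y|right].
- apply: (star_fire (h := Z) (s' := AFreeze d) (w := [:: Z])
    (m' := acount 1 (fun x => m x + b x) zero zero zero zero)) => //.
  + by apply/sp_guardE => //; rewrite hfl eqxx.
  + by case=> [|x|x|x|x|x]; rewrite coloured_eqE /= ?coloured_eqE //= ?addn0.
  apply: (star_fire (h := T1 y) (s' := ACopy d) (w := [:: Tb y])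
    (m' := acount 1 m zero zero zero b)) => //.
  + by apply/sp_guardE.
  + by rewrite /= hb' eqxx addn1.
  by case=> [|x|x|x|x|x];
    rewrite coloured_eqE /= ?coloured_eqE ?addn0 ?hb' //= eq_sym ?addn0.
apply: (star_fire (h := Z) (s' := ACopy d) (w := [:: Z])
    (m' := acount 1 m zero zero zero b)) => //.
- by apply/sp_guardE => //; rewrite hfl eqxx.
by case=> [|x|x|x|x|x]; rewrite coloured_eqE /= ?coloured_eqE ?hb' //= ?addn0.
Qed.

(** The last clause of [lasso]. *)
Definition frozen (b : 'I_n -> nat) : Prop :=
  if fl then exists y, forall x, b x = (x == y) else forall x, b x = 0.

(* The invariant of the last phase: the loop runs from c to c', pend counts a copy
   whose task is still to be removed, and only handlers of the loop, among them those
   satisfying q, may have been discarded. *)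
Definition checking (pend : 'I_n -> nat) (q : 'I_n -> Prop) (m : coloured n -> nat)
    s0 m0 : Prop :=
  exists d c b c' tr1 tr2,
    [/\ exec PL s0 m0 tr1 d (fun x => c x + b x + m (T1 x)), exec PL d c tr2 d c',
        frozen b, tr2 <> [::] &
        forall x,
        [/\ c x + m (T2 x) <= c' x + m (T3 x) + pend x, m (T2 x) <= c' x,
            m (T3 x) <= c x, m (Tb x) <= b x &
            x \in tr2 \/ [/\ ~ q x, m (Tg x) = 0, m (T2 x) = c' x & m (Tb x) = b x]]].

(** Tasks [T1] left behind by a premature end of copying are never consumed later; they stay in the
    formulas until the empty final multiset excludes them. In [AMark] the mark of the handler just
    executed is still due. *)
Definition ainv s0 m0 (s : astate (states P) n) (m : coloured n -> nat) : Prop :=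
  match s with
  | ARun d | AFreeze d =>
    [/\ (if s is AFreeze _ then fl else true),
        exists tr, exec PL s0 m0 tr d (fun x => m (T1 x)) &
        forall x, [/\ m (T2 x) = 0, m (T3 x) = 0, m (Tg x) = 0 & m (Tb x) = 0]]
  | ACopy d =>
    [/\ frozen (fun x => m (Tb x)),
        exists tr, exec PL s0 m0 tr d (fun x => m (T1 x) + m (T2 x) + m (Tb x)) &
        forall x, m (T3 x) = m (T2 x) /\ m (Tg x) = 0]
  | ALoop e d | AMark e d _ =>
    exists tr1 tr2,
    [/\ frozen (fun x => m (Tb x)),
        exec PL s0 m0 tr1 e (fun x => m (T1 x) + m (T3 x) + m (Tb x)),
        exec PL e (fun x => m (T3 x)) tr2 d (fun x => m (T2 x)) &
        forall x, (0 < m (Tg x) -> x \in tr2) /\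
          (if s is AMark _ _ y then x = y -> x \in tr2 else True)]
  | ACheck y => checking zero (fun x => x = y) m s0 m0
  | AMatch y => checking (fun x => y == x) (fun x => x = y) m s0 m0
  | ADone => checking zero (fun=> False) m s0 m0
  end.

Lemma frozen_ext b b' : b =1 b' -> frozen b -> frozen b'.
Proof.
move=> e; rewrite /frozen; case: fl => [[y h]|h]; first by exists y => x; rewrite -e.
by move=> x; rewrite -e.
Qed.

Ltac components em ew x :=
  move: (em (T1 x)) (em (T2 x)) (em (T3 x)) (em (Tg x)) (em (Tb x));
  rewrite ew /= !coloured_eqE /=.

Ltac components_map em ew counts x :=
  let e1 := fresh in let e2 := fresh in let e3 := fresh in
  let e4 := fresh in let e5 := fresh in
  have [e1 e2 e3 e4 e5] := counts;
  move: (em (T1 x)) (em (T2 x)) (em (T3 x)) (em (Tg x)) (em (Tb x));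
  rewrite ew e1 e2 e3 e4 e5 !coloured_eqE /=.

Lemma count_T1 x (u : seq 'I_n) : [/\ count_mem (T1 x) (map (@T1 n) u) = count_mem x u,
  count_mem (T2 x) (map (@T1 n) u) = 0, count_mem (T3 x) (map (@T1 n) u) = 0,
  count_mem (Tg x) (map (@T1 n) u) = 0 & count_mem (Tb x) (map (@T1 n) u) = 0].
Proof.
by split; rewrite ?count_map_inj //; apply: count_map_disjoint => y; rewrite coloured_eqE.
Qed.

Lemma count_T2 x (u : seq 'I_n) : [/\ count_mem (T1 x) (map (@T2 n) u) = 0,
  count_mem (T2 x) (map (@T2 n) u) = count_mem x u, count_mem (T3 x) (map (@T2 n) u) = 0,
  count_mem (Tg x) (map (@T2 n) u) = 0 & count_mem (Tb x) (map (@T2 n) u) = 0].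
Proof.
by split; rewrite ?count_map_inj //; apply: count_map_disjoint => y; rewrite coloured_eqE.
Qed.

Lemma ainvariant s0 m0 tr s m :
  exec L (ARun s0) (acount 1 m0 zero zero zero zero) tr s m -> ainv s0 m0 s m.
Proof.
apply: (exec_inv (I := fun s m _ => ainv s0 m0 s m)) => {tr s m}.
  move=> m e; split=> // [|x]; last by rewrite -!e.
  by exists [::]; split=> // x; rewrite -e.
move=> s1 m1 _ h s2 m2 + /fireE [h0 [w hw em]].
case: s1 h s2 hw em h0 => [d|d|d|e d|e d x|x|x|] [|y|y|y|y|y]
  [d'|d'|d'|e' d'|e' d' x'|x'|x'|] //= hw em h0;
  try (by case: (sp_emptyE hrE hw)).
- move: hw => /(sp_guardE hr1 hrE) [/andP [hfl /eqP <-] ew] [_ [t ht] h2].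
  split=> // [|x]; last by case: (h2 x) => *; split; components em ew x; lia.
  by exists t; apply: exec_ext ht => // x; components em ew x; lia.
- move: hw => /(sp_guardE hr1 hrE) [/andP [/negbTE hfl /eqP <-] ew] [_ [t ht] h2].
  split=> [||x]; last by case: (h2 x) => *; components em ew x; lia.
    by rewrite /frozen hfl => x; case: (h2 x) => *; components em ew x; lia.
  by exists t; apply: exec_ext ht => // x; case: (h2 x) => *; components em ew x; lia.
- move: hw => /sp_ctxE [u hu ew] [_ [t ht] h2]; split=> // [|x]; last first.
    by case: (h2 x) => *; split; components_map em ew (count_T1 x u) x; lia.
  exists (t ++ [:: y]); apply: exec_cat ht (exec_fire _).
  apply/fireE; split=> //; exists u => // x; have [e1 _ _ _ _] := count_T1 x u.
  by move: (em (T1 x)); rewrite ew e1 coloured_eqE.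
- move: hw => /(sp_guardE hr1 hrE) [/eqP <- ew] [hfl [t ht] h2].
  split=> [||x]; last by case: (h2 x) => *; components em ew x; lia.
    rewrite /frozen hfl; exists y => x; case: (h2 x) => *; rewrite eq_sym.
    by components em ew x; lia.
  by exists t; apply: exec_ext ht => // x; case: (h2 x) => *; components em ew x; lia.
(* The loop starts with an empty trace, since [T2] and [T3] agree when copying ends. *)
- move: hw => /(sp_guardE hr1 hrE) [/andP [/eqP <- /eqP <-] ew] [hb [t ht] h2].
  exists t, [::]; split=> //.
  + by apply: frozen_ext hb => x; components em ew x; lia.
  + by apply: exec_ext ht => // x; move: (h2 x); components em ew x; lia.
  + by split=> // x; move: (h2 x); components em ew x; lia.
  + by move=> x; split=> //; move: (h2 x); components em ew x; lia.
- move: hw => /(sp_guardE hr1 hrE) [/eqP <- ew] [hb [t ht] h2].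
  split=> [||x]; last by move: (h2 x); components em ew x; lia.
    by apply: frozen_ext hb => x; components em ew x; lia.
  by exists t; apply: exec_ext ht => // x; move: (h2 x); components em ew x; lia.
- move: hw; rewrite /system /=; case: ifP => [|_ /(sp_emptyE hrE) //].
  move=> /andP [/eqP <- /eqP <-] /sp_ctxE [u hu ew] [t1 [t2 [hb ht1 ht2 h2]]].
  exists t1, (t2 ++ [:: y]); split.
  + by apply: frozen_ext hb => x; components_map em ew (count_T2 x u) x; lia.
  + apply: exec_ext ht1 => // x; components_map em ew (count_T2 x u) x; lia.
  + apply: (@exec_ext _ _ _ _ (fun x => m1 (T3 x)) _ _ _ (fun x => m2 (T2 x))) => // [x|].
      by components_map em ew (count_T2 x u) x; lia.
    apply: exec_cat ht2 (exec_fire _).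
    apply/fireE; split=> //; exists u => // x; have [_ e2 _ _ _] := count_T2 x u.
    by move: (em (T2 x)); rewrite ew e2 coloured_eqE.
  + move=> x; split=> [hx|->]; rewrite mem_cat; last by rewrite mem_head orbT.
    have [hx2 _] := h2 x; apply/orP; left; apply: hx2; move: hx.
    by components_map em ew (count_T2 x u) x; lia.
(* The guard closes the loop. The counts of [T3], [Tb] and [T2] at this moment are recorded as [c],
   [b] and [c']; the mark consumed shows that [y] was executed. *)
- move: hw => /(sp_guardE hr1 hrE) [/andP [/eqP eed /eqP <-] ew].
  rewrite -eed => -[t1 [t2 [hb ht1 ht2 h2]]].
  have yt2 : y \in t2 by have [hy _] := h2 y; apply: hy.
  exists e, (fun x => m1 (T3 x)), (fun x => m1 (Tb x)), (fun x => m1 (T2 x)), t1, t2.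
  split=> //.
  + by apply: exec_ext ht1 => // x; components em ew x; lia.
  + by move=> e0; rewrite e0 in yt2.
  + move=> x; case: (boolP (x \in t2)) => hx.
      by split; [..|by left]; components em ew x; lia.
    have [hg _] := h2 x.
    have m1g : m1 (Tg x) = 0 by case: (posnP (m1 (Tg x))) => // /hg; rewrite (negbTE hx).
    split; [..|right; split]; try (by components em ew x; lia).
    by move=> exy; move: hx; rewrite exy yt2.
- move: hw => /(sp_guardE hr1 hrE) [/andP [/eqP <- /eqP <-] ew] [t1 [t2 [hb ht1 ht2 h2]]].
  exists t1, t2; split.
  + by apply: frozen_ext hb => z; components em ew z; lia.
  + by apply: exec_ext ht1 => // z; components em ew z; lia.
  + by apply: exec_ext ht2 => z; components em ew z; lia.
  + move=> z; split=> // hz; have [hg hx] := h2 z.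
    case: (x =P z) => [exz|/eqP/negbTE nxz]; first exact: hx.
    by apply: hg; move: hz; components em ew z; rewrite nxz; lia.
- move: hw => /(sp_guardE hr1 hrE) [_ ew].
  move=> [d1 [c [b [c' [t1 [t2]]]]]] [ht1 ht2 hb hne hall].
  exists d1, c, b, c', t1, t2; split=> // [|z].
    by apply: exec_ext ht1 => // z; components em ew z; lia.
  case: (hall z) => a1 a2 a3 a4 a5; split; try (by components em ew z; lia).
  case: a5 => [|[nq a6 a7 a8]]; [by left|right].
  by split=> //; components em ew z; lia.
- move: hw => /(sp_guardE hr1 hrE) [/andP [/eqP exy /eqP exz] ew].
  rewrite -exz; rewrite -exy in em h0.
  move=> [d1 [c [b [c' [t1 [t2]]]]]] [ht1 ht2 hb hne hall].
  exists d1, c, b, c', t1, t2; split=> // [|z].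
    by apply: exec_ext ht1 => // z; components em ew z; lia.
  case: (hall z) => a1 a2 a3 a4 a5; split; try (by components em ew z; lia).
  case: a5 => [|[nq a6 a7 a8]]; [by left|right].
  (* Only the current handler is altered, so a handler outside the loop keeps its counts. *)
  have /negbTE nxz : x != z by apply/eqP => e; apply: nq.
  by split=> //; components em ew z; rewrite ?nxz; lia.
- move: hw => /(sp_guardE hr1 hrE) [/andP [/eqP exy /eqP exz] ew].
  rewrite -exz; rewrite -exy in em h0.
  move=> [d1 [c [b [c' [t1 [t2]]]]]] [ht1 ht2 hb hne hall].
  exists d1, c, b, c', t1, t2; split=> // [|z].
    by apply: exec_ext ht1 => // z; components em ew z; lia.
  case: (hall z) => a1 a2 a3 a4 a5; split; try (by components em ew z; lia).
  case: a5 => [|[nq a6 a7 a8]]; [by left|right].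
  have /negbTE nxz : x != z by apply/eqP => e; apply: nq.
  by split=> //; components em ew z; rewrite ?nxz; lia.
- move: hw => /(sp_guardE hr1 hrE) [/eqP eyz ew]; rewrite -eyz.
  move=> [d1 [c [b [c' [t1 [t2]]]]]] [ht1 ht2 hb hne hall].
  exists d1, c, b, c', t1, t2; split=> // [|z].
    by apply: exec_ext ht1 => // z; components em ew z; lia.
  case: (hall z) => a1 a2 a3 a4 a5; split; try (by components em ew z; lia).
  case: a5 => [|[nq a6 a7 a8]]; [by left|right].
  (* The new current handler had a mark, whereas [z] has none. *)
  have /negbTE nyz : y != z by apply/eqP => e; move: h0; rewrite e a6.
  split; try (by components em ew z; rewrite ?nyz; lia).
  by move=> e; rewrite e eqxx in nyz.
- move: hw => /(sp_guardE hr1 hrE) [/andP [/eqP exy /eqP exz] ew].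
  rewrite -exz; rewrite -exy in em h0.
  move=> [d1 [c [b [c' [t1 [t2]]]]]] [ht1 ht2 hb hne hall].
  exists d1, c, b, c', t1, t2; split=> // [|z].
    by apply: exec_ext ht1 => // z; components em ew z; lia.
  case: (hall z) => a1 a2 a3 a4 a5; split; try (by components em ew z; lia).
  case: a5 => [|[nq a6 a7 a8]]; [by left|right].
  have /negbTE nxz : x != z by apply/eqP => e; apply: nq.
  by split=> //; components em ew z; rewrite ?nxz; lia.
- move: hw => /(sp_guardE hr1 hrE) [/andP [/eqP exy /eqP exz] ew].
  rewrite -exz; rewrite -exy in em h0.
  move=> [d1 [c [b [c' [t1 [t2]]]]]] [ht1 ht2 hb hne hall].
  exists d1, c, b, c', t1, t2; split=> // [|z].
    by apply: exec_ext ht1 => // z; components em ew z; lia.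
  case: (hall z) => a1 a2 a3 a4 a5; split; try (by components em ew z; lia).
  case: a5 => [|[nq a6 a7 a8]]; [by left|right].
  have /negbTE nxz : x != z by apply/eqP => e; apply: nq.
  by split=> //; components em ew z; rewrite ?nxz; lia.
Qed.

(** When all counts are 0, the clauses of [checking] become those of [lasso]: the first inequality
    gives growth, and handlers outside the loop have nothing pending at its end. *)
Lemma areach_lasso s0 m0 :
  star L (ARun s0) (acount 1 m0 zero zero zero zero) ADone zero -> lasso PL fl s0 m0.
Proof.
move=> [tr /ainvariant [d [c [b [c' [t1 [t2 [h1 h2 hb hne hall]]]]]]]].
exists d, c, b, c', t1, t2; split=> // [|x|].
- by apply: exec_ext h1 => // x; rewrite addn0.
- by case: (hall x) => *; lia.
split=> // x; case: (hall x) => _ _ _ _ [|[_ _ e1 e2]]; [by left|right].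
by rewrite -e1 -e2.
Qed.

End LassoToReach.

(** * Balanced words *)

Inductive zstate : Type := ZStart | ZTest | ZMatch.

Section BalancedWords.
Variables (C : lang_class) (r1 rE : nat).
Hypothesis ok1 : is_rep C 1 r1.
Hypothesis okE : is_rep C 1 rE.
Hypothesis hr1 : forall w : seq 'I_1, lang C r1 w <-> w = [:: ord0].
Hypothesis hrE : forall w : seq 'I_1, ~ lang C rE w.

Variable r : nat.

(** [T1 ord0] and [T1 ord_max] stand for the letters a and b; the first task posts a word, and each
    cancellation removes an a and then a b. *)
Definition zspec (s : zstate) (h : coloured 2) (s' : zstate) : spec (coloured 2) :=
  match s, h, s' with
  | ZStart, Z, ZTest => @Spec _ 2 r (fun x => [:: T1 x])
  | ZTest, T1 x, ZMatch => sp_guard r1 rE (x == ord0) [::]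
  | ZMatch, T1 x, ZTest => sp_guard r1 rE (x == ord_max) [::]
  | _, _, _ => sp_empty rE _
  end.

Definition zcount (h : coloured 2) : nat := if h is Z then 1 else 0.

Local Notation L := (system C zspec).

Lemma zspec_ok s h s' : is_rep C 2 r -> spec_ok C (zspec s h s').
Proof.
move=> hr; case: s h s' => [||] [|y|y|y|y|y] [||] /=;
  by first [exact: sp_empty_ok okE _|exact: sp_guard_ok|exact: hr].
Qed.

Let T1_inj : injective (@T1 2). Proof. by move=> x y []. Qed.

Lemma ord2P (x : 'I_2) : x = ord0 \/ x = ord_max.
Proof. by case: x => -[|[|x]] // hx; [left|right]; apply: val_inj. Qed.

Definition zletters (k : nat) (h : coloured 2) : nat := if h is T1 _ then k else 0.

Lemma ztest_match k : star L ZTest (zletters k) ZTest (fun=> 0).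
Proof.
elim: k => [|k ih]; first by apply: star_refl; case.
apply: (star_fire (h := T1 ord0) (s' := ZMatch) (w := [::])
  (m' := fun h => zletters k h + (T1 ord_max == h))) => //.
- by apply/sp_guardE.
- case=> [|x|x|x|x|x]; rewrite !coloured_eqE //=.
  by have [->|->] := ord2P x; rewrite /= ?eqxx; lia.
apply: (star_fire (h := T1 ord_max) (s' := ZTest) (w := [::]) (m' := zletters k)) ih => //.
- by apply/sp_guardE.
- by rewrite eqxx addn1.
- by move=> x; rewrite addn0.
Qed.

Lemma zreachE : star L ZStart zcount ZTest (fun=> 0) <->
  exists2 w : seq 'I_2, lang C r w & Z_lang w.
Proof.
split=> [[tr htr]|[w hw wZ]]; last first.
  apply: (star_fire (h := Z) (s' := ZTest) (w := map (@T1 2) w)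
    (m' := zletters (count_mem ord0 w))) => //.
  - by exists w => //; rewrite -flatten_map1.
  - case=> [|x|x|x|x|x]; rewrite coloured_eqE /= ?count_map_inj ?addn0 ?add0n //;
      try by rewrite count_map_disjoint => // ?; rewrite coloured_eqE.
    by have [->|->] := ord2P x; rewrite // wZ.
  exact: ztest_match.
(* The difference of the letter counts of [w] is preserved; [k] is 1 while an a has been removed and
   its b has not. *)
pose bal k (m : coloured 2 -> nat) := exists2 w : seq 'I_2, lang C r w &
  m (T1 ord0) + count_mem (ord_max : 'I_2) w + k =
  m (T1 ord_max) + count_mem (ord0 : 'I_2) w.
pose I s (m : coloured 2 -> nat) (_ : seq (coloured 2)) := match s with
  | ZStart => forall x, m (T1 x) = 0 | ZTest => bal 0 m | ZMatch => bal 1 m end.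
have inv t s m : exec L ZStart zcount t s m -> I s m t; last first.
  by have [w hw] := inv _ _ _ htr; rewrite /= !add0n addn0 => e; exists w.
apply: (exec_inv (I := I)) => {t s m} [m e x|s1 m1 t h s2 m2 + /fireE [h0 [w hw em]]].
  by rewrite -e.
case: s1 h s2 hw em h0 => [||] [|y|y|y|y|y] [||] //= hw em h0;
  try (by case: (sp_emptyE hrE hw)).
- move: hw => [u hu ew] m1z; exists u => //; move: ew; rewrite /= flatten_map1 => ew.
  move: (em (T1 ord0)) (em (T1 ord_max)).
  by rewrite ew !count_map_inj // !m1z !coloured_eqE /=; lia.
- move: hw => /(sp_guardE hr1 hrE) [/eqP ey ew] [u hu e]; exists u => //.
  by move: e (em (T1 ord0)) (em (T1 ord_max)); rewrite ew ey !coloured_eqE /=; lia.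
- move: hw => /(sp_guardE hr1 hrE) [/eqP ey ew] [u hu e]; exists u => //.
  by move: e (em (T1 ord0)) (em (T1 ord_max)); rewrite ew ey !coloured_eqE /=; lia.
Qed.

End BalancedWords.

(** * Numerical descriptions of the constructed programs *)

Lemma computable_code_ctx m x d s d' tag :
  computable m -> computable x -> computable d -> computable s -> computable d' ->
  computable (fun v => code_ctx (m v) (x v) (d v) (s v) (d' v) tag).
Proof.
move=> hm hx hd hs hd'; rewrite /code_ctx /nhandlers /nrep.
do ![apply: computable_npair]; try by computable_tac.
by apply: (computable_table (g := fun _ i => (npair (npair tag i) 0).+1)); computable_tac.
Qed.

Lemma computable_code_guard r1 rE m b w :
  computable m -> computable_bool b -> computable w ->
  computable (fun v => code_guard r1 rE (m v) (b v) (w v)).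
Proof. by move=> hm hb hw; rewrite /code_guard /code_empty; computable_tac. Qed.

Lemma computable_code_empty rE m :
  computable m -> computable (fun v => code_empty rE (m v)).
Proof. by move=> hm; rewrite /code_empty; computable_tac. Qed.

Lemma computable_coloured_valid n j : computable n -> computable j ->
  computable_bool (fun v => coloured_valid (n v) (j v)).
Proof. by move=> hn hj; rewrite /coloured_valid; computable_tac. Qed.

Lemma computable_ncoloured n : computable n -> computable (fun v => ncoloured (n v)).
Proof. by move=> hn; rewrite /ncoloured; computable_tac. Qed.

Ltac computable_prog := repeat match goal with
  | |- computable (fun v => code_ctx (@?f1 v) (@?f2 v) (@?f3 v) (@?f4 v) (@?f5 v) (@?f6 v)) =>
      apply: computable_code_ctx
  | |- computable (fun v => code_guard (@?f1 v) (@?f2 v) (@?f3 v) (@?f4 v) (@?f5 v)) =>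
      apply: computable_code_guard
  | |- computable (fun v => code_empty (@?f1 v) (@?f2 v)) => apply: computable_code_empty
  | |- computable_bool (fun v => coloured_valid (@?f1 v) (@?f2 v)) =>
      apply: computable_coloured_valid
  | |- computable (fun v => ncoloured (@?f1 v)) => apply: computable_ncoloured
  | _ => computable_step
  end.

Section Codes.
Variables (r1 rE : nat).

Section BCode.
Variables D n : nat.

Definition bstate_code (s : bstate D n) : nat :=
  match s with BRun d => npair 0 d | BTest => npair 1 0 | BMatch x => npair 2 x end.

Lemma bstate_code_inj : injective bstate_code.
Proof. by move=> [d||x] [d'||x'] //= /npair_inj [] // _ /val_inj ->. Qed.

Definition bvalid i := [|| (nfst i == 0) && (nsnd i < D), i == npair 1 0 |
  (nfst i == 2) && (nsnd i < n)].

Lemma bvalidP i : bvalid i -> exists s, i = bstate_code s.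
Proof.
case/or3P => [/andP [/eqP e h]|/eqP ->|/andP [/eqP e h]].
- by exists (BRun (Ordinal h)); rewrite /= -e npair_nfst_nsnd.
- by exists BTest.
- by exists (BMatch (Ordinal h)); rewrite /= -e npair_nfst_nsnd.
Qed.

Lemma bstate_code_valid s : bvalid (bstate_code s).
Proof.
by rewrite /bvalid; case: s => [d||x] /=; rewrite ?npairK ?eqxx ?ltn_ord ?orbT.
Qed.

Lemma bstate_code_bound s : bstate_code s < (npair 2 (npair D n)).+1.
Proof.
rewrite ltnS; case: s => [d||x]; apply: leq_npair => //=.
  by apply: leq_trans (ltnW (ltn_ord d)) (leq_npairl _ _).
by apply: leq_trans (ltnW (ltn_ord x)) (leq_npairr _ _).
Qed.

End BCode.

Definition wZ : nat := (npair (npair 0 0) 0).+1.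

(** The cases of [bspec], told apart by the tags of the two states and the handler; validity is
    tested first so that junk indices get the empty language. *)
Definition bcode (p dt i j k : nat) : nat :=
  let n := nhandlers p in let m := ncoloured n in
  let tags := npair (nfst i) (npair (nfst j) (nfst k)) in
  if bvalid (nstates p) n i && coloured_valid n j && bvalid (nstates p) n k then
    if tags == npair 0 (npair 1 0) then code_ctx m p (nsnd i) (nsnd j) (nsnd k) 1
    else if tags == npair 0 (npair 0 1) then code_guard r1 rE m (nsnd i == dt) wZ
    else if tags == npair 1 (npair 0 1) then code_guard r1 rE m true wZ
    else if tags == npair 1 (npair 2 2) then code_guard r1 rE m (nsnd j == nsnd k) 0
    else if tags == npair 2 (npair 1 1) then code_guard r1 rE m (nsnd i == nsnd j) 0
    else code_empty rE m
  else code_empty rE m.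

Lemma bcodeE P (dt : 'I_(states P)) (s : bstate (states P) (handlers P)) h
    (s' : bstate (states P) (handlers P)) :
  bcode (enc_prog P) dt (bstate_code s) (coloured_code h) (bstate_code s') =
  spec_code (ncoloured (handlers P)) (@coloured_code _) (bspec r1 rE dt s h s').
Proof.
rewrite /bcode !nstatesE !nhandlersE !bstate_code_valid coloured_code_valid /=.
case: s h s' => [d||x] [|y|y|y|y|y] [d'||x'] /=; rewrite !npairK !npair_eq /=;
  rewrite ?sp_empty_code ?sp_guard_code //.
by rewrite (@sp_ctx_code _ _ _ _ _ _ _ 1).
Qed.

Definition bmu (p c j : nat) : nat :=
  if coloured_valid (nhandlers p) j then
    if nfst j == 0 then 2 else
    if nfst j == 1 then nmset0 p (nsnd j) else
    if nfst j == 2 then dnth (nsnd c) (nsnd j) else 0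
  else 0.

Section ACode.
Variables D n : nat.

Definition astate_code (s : astate D n) : nat :=
  match s with
  | ARun d => npair 0 d | AFreeze d => npair 1 d | ACopy d => npair 2 d
  | ALoop e d => npair 3 (npair e d) | AMark e d x => npair 4 (npair e (npair d x))
  | ACheck x => npair 5 x | AMatch x => npair 6 x | ADone => npair 7 0
  end.

Lemma astate_code_inj : injective astate_code.
Proof.
by move=> [d|d|d|e d|e d x|x|x|] [d'|d'|d'|e' d'|e' d' x'|x'|x'|] //= /npair_inj [] // _;
  do ?[move=> /npair_inj [/val_inj ->]]; move=> // /val_inj ->.
Qed.

Definition avalid i := [|| (nfst i <= 2) && (nsnd i < D),
  [&& nfst i == 3, nfst (nsnd i) < D & nsnd (nsnd i) < D],
  [&& nfst i == 4, nfst (nsnd i) < D, nfst (nsnd (nsnd i)) < D &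
     nsnd (nsnd (nsnd i)) < n],
  [&& 5 <= nfst i, nfst i <= 6 & nsnd i < n] | i == npair 7 0].

Lemma avalidP i : avalid i -> exists s, i = astate_code s.
Proof.
rewrite -[i]npair_nfst_nsnd /avalid !npairK; move: (nfst i) (nsnd i) => t u.
case/or4P => [/andP [ht hu]|/and3P [/eqP -> h1 h2]|/and4P [/eqP -> h1 h2 h3]|].
- case: t ht => [|[|[|]]] // _.
  + by exists (ARun (Ordinal hu)).
  + by exists (AFreeze (Ordinal hu)).
  + by exists (ACopy (Ordinal hu)).
- by exists (ALoop (Ordinal h1) (Ordinal h2)); rewrite /= npair_nfst_nsnd.
- by exists (AMark (Ordinal h1) (Ordinal h2) (Ordinal h3)); rewrite /= !npair_nfst_nsnd.
case/orP => [/and3P [h5 h6 hu]|/eqP ->]; last by exists ADone.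
case: t h5 h6 => [|[|[|[|[|[|[|]]]]]]] // _ _.
- by exists (ACheck (Ordinal hu)).
- by exists (AMatch (Ordinal hu)).
Qed.

Lemma astate_code_valid s : avalid (astate_code s).
Proof.
by rewrite /avalid; case: s => [d|d|d|e d|e d x|x|x|] /=;
  rewrite ?npairK ?ltn_ord ?npair_eq ?eqxx ?orbT.
Qed.

Lemma astate_code_bound s : astate_code s < (npair 7 (npair D (npair D n))).+1.
Proof.
have hd (d : 'I_D) a : d <= npair D a.
  exact: leq_trans (ltnW (ltn_ord d)) (leq_npairl _ _).
have hx (x : 'I_n) a b : x <= npair a (npair b n).
  by do 2!apply: leq_trans (leq_npairr _ _); apply: ltnW.
rewrite ltnS; case: s => [d|d|d|e d|e d x|x|x|]; apply: leq_npair => //=.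
- by apply: leq_npair => //; apply: ltnW.
- by apply: leq_npair; [|apply: leq_npair]; apply: ltnW.
Qed.

End ACode.

(** The cases of [aspec] by tags: states have tags 0 to 7 and handlers 0 to 5, in the order of their
    constructors. Posted words are written out as codes. *)
Definition acode (fl : bool) (p i j k : nat) : nat :=
  let n := nhandlers p in let m := ncoloured n in
  let tags := npair (nfst i) (npair (nfst j) (nfst k)) in
  let tag3 a b c := tags == npair a (npair b c) in
  let guard := code_guard r1 rE m in
  if avalid (nstates p) n i && coloured_valid n j && avalid (nstates p) n k then
    if tag3 0 1 0 then code_ctx m p (nsnd i) (nsnd j) (nsnd k) 1
    else if tag3 0 0 1 then guard (fl && (nsnd i == nsnd k)) wZ
    else if tag3 0 0 2 then guard (~~ fl && (nsnd i == nsnd k)) wZ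
    else if tag3 1 1 2 then guard (nsnd i == nsnd k) (npair (npair 5 (nsnd j)) 0).+1
    else if tag3 2 1 2 then guard (nsnd i == nsnd k)
      (npair (npair 2 (nsnd j)) (npair (npair 3 (nsnd j)) 0).+1).+1
    else if tag3 2 0 3 then
      guard ((nsnd i == nfst (nsnd k)) && (nsnd i == nsnd (nsnd k))) wZ
    else if tag3 3 2 4 then
      if (nfst (nsnd i) == nfst (nsnd k)) && (nsnd j == nsnd (nsnd (nsnd k)))
      then code_ctx m p (nsnd (nsnd i)) (nsnd j) (nfst (nsnd (nsnd k))) 2
      else code_empty rE m
    else if tag3 4 0 3 then
      guard ((nfst (nsnd i) == nfst (nsnd k)) &&
             (nfst (nsnd (nsnd i)) == nsnd (nsnd k)))
        (npair (npair 0 0) (npair (npair 4 (nsnd (nsnd (nsnd i)))) 0).+1).+1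
    else if tag3 3 4 5 then
      guard ((nfst (nsnd i) == nsnd (nsnd i)) && (nsnd j == nsnd k)) 0
    else if tag3 5 2 5 then guard ((nsnd i == nsnd j) && (nsnd i == nsnd k)) 0
    else if tag3 5 5 5 then guard ((nsnd i == nsnd j) && (nsnd i == nsnd k)) 0
    else if tag3 5 3 6 then guard ((nsnd i == nsnd j) && (nsnd i == nsnd k)) 0
    else if tag3 6 2 5 then guard ((nsnd i == nsnd j) && (nsnd i == nsnd k)) 0
    else if tag3 5 4 5 then guard (nsnd j == nsnd k) 0
    else if tag3 5 0 7 then guard true 0
    else code_empty rE m
  else code_empty rE m.

Lemma acodeE fl P (s : astate (states P) (handlers P)) h
    (s' : astate (states P) (handlers P)) :
  acode fl (enc_prog P) (astate_code s) (coloured_code h) (astate_code s') =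
  spec_code (ncoloured (handlers P)) (@coloured_code _) (aspec r1 rE fl s h s').
Proof.
rewrite /acode !nstatesE !nhandlersE !astate_code_valid coloured_code_valid /=.
case: s => [d|d|d|e d|e d x|x|x|]; rewrite /= !npairK !npair_eq /=;
  (case: h => [|y|y|y|y|y]; rewrite /= ?npairK /= ?sp_empty_code //;
   case: s' => [d'|d'|d'|e' d'|e' d' x'|x'|x'|];
   rewrite /= ?npairK /= ?sp_empty_code ?sp_guard_code //).
- by rewrite (@sp_ctx_code _ _ _ _ _ _ _ 1).
- rewrite -!val_eqE /=; case: ifP => _; rewrite ?sp_empty_code //.
  by rewrite (@sp_ctx_code _ _ _ _ _ _ _ 2).
Qed.

Definition amu (p j : nat) : nat :=
  if coloured_valid (nhandlers p) j then
    if nfst j == 0 then 1 else if nfst j == 1 then nmset0 p (nsnd j) else 0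
  else 0.

Definition zstate_code (s : zstate) : nat :=
  match s with ZStart => 0 | ZTest => 1 | ZMatch => 2 end.

Lemma zstate_code_inj : injective zstate_code.
Proof. by move=> [] []. Qed.

Lemma zstate_codeP i : i < 3 -> exists s, i = zstate_code s.
Proof. by case: i => [|[|[|]]] // _; [exists ZStart|exists ZTest|exists ZMatch]. Qed.

Definition zcode (r i j k : nat) : nat :=
  let m := ncoloured 2 in
  let tags := npair i (npair (nfst j) k) in
  if (i < 3) && coloured_valid 2 j && (k < 3) then
    if tags == npair 0 (npair 0 1) then
      npair 2 (npair m (npair r (enc_seq (fun x => (npair (npair 1 x) 0).+1) (iota 0 2))))
    else if tags == npair 1 (npair 1 2) then code_guard r1 rE m (nsnd j == 0) 0
    else if tags == npair 2 (npair 1 1) then code_guard r1 rE m (nsnd j == 1) 0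
    else code_empty rE m
  else code_empty rE m.

Lemma zcodeE r s h s' :
  zcode r (zstate_code s) (coloured_code h) (zstate_code s') =
  spec_code (ncoloured 2) (@coloured_code _) (zspec r1 rE r s h s').
Proof.
rewrite /zcode coloured_code_valid.
have -> : (zstate_code s < 3) && true && (zstate_code s' < 3) by case: s s' => [||] [||].
case: s h s' => [||] [|y|y|y|y|y] [||]; rewrite /= !npairK !npair_eq /=;
  rewrite ?sp_empty_code ?sp_guard_code //.
by rewrite /spec_code /= (enc_funE (g := fun x => (npair (npair 1 x) 0).+1)).
Qed.

End Codes.

(** * The reductions *)

Lemma rec_decidable_reduce X Y (encX : X -> nat) (encY : Y -> nat)
    (domX : X -> Prop) (domY : Y -> Prop) (QX : X -> Prop) (QY : Y -> Prop) :
  (exists g, forall x, domX x ->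
     exists y, [/\ domY y, eval g (encX x) (encY y) & QX x <-> QY y]) ->
  rec_decidable encY domY QY -> rec_decidable encX domX QX.
Proof.
move=> [g hg] [c hc]; exists (CComp c g) => x /hg [y [dy hgy hq]].
have [b hb hbq] := hc y dy; exists b; last by rewrite hq.
by exists (encY y).
Qed.

Lemma rec_decidable_not X (enc : X -> nat) (dom : X -> Prop) (Q : X -> Prop) :
  rec_decidable enc dom Q -> rec_decidable enc dom (fun x => ~ Q x).
Proof.
have [d hd] : computable (fun x => 1 - x) by computable_tac.
move=> [c hc]; exists (CComp d c) => x /hc [b hb hq].
exists (~~ b); last by rewrite -hq; split; [exact/negP|move/negP].
by exists b => //; have := hd b; case: (b).
Qed.

Lemma rec_decidable_iff X (enc : X -> nat) (dom : X -> Prop) (Q Q' : X -> Prop) :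
  (forall x, dom x -> (Q x <-> Q' x)) ->
  rec_decidable enc dom Q -> rec_decidable enc dom Q'.
Proof.
move=> hQ [c hc]; exists c => x dx.
by have [b hb hq] := hc x dx; exists b => //; rewrite hq; apply: hQ.
Qed.

Lemma rec_decidable_notnot X (enc : X -> nat) (dom : X -> Prop) (Q : X -> Prop) :
  rec_decidable enc dom (fun x => ~ Q x) -> rec_decidable enc dom Q.
Proof.
move=> /rec_decidable_not; apply: rec_decidable_iff => x _.
by split; [exact: NNPP|move=> h; apply].
Qed.

Lemma rec_decidable_const X (enc : X -> nat) (dom : X -> Prop) (Q : X -> Prop)
    (b : bool) :
  (forall x, dom x -> (b <-> Q x)) -> rec_decidable enc dom Q.
Proof.
move=> h; have [c hc] := computable_const b; exists c => x dx.
by exists b; [exact: hc|exact: h].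
Qed.

Section NonTrivial.
Variables (C : lang_class) (r1 rE : nat).
Hypothesis C_image : closed_hom_image C.
Hypothesis ok1 : is_rep C 1 r1.
Hypothesis okE : is_rep C 1 rE.
Hypothesis hr1 : forall w : seq 'I_1, lang C r1 w <-> w = [:: ord0].
Hypothesis hrE : forall w : seq 'I_1, ~ lang C rE w.

(** Provides the alternative that [compile] asks for: indices that number no context get the empty
    specification. *)
Lemma empty_case (H : Type) (num : nat) n (eH : H -> nat) (Q : Prop) :
  (~ Q -> num = code_empty rE n) ->
  Q \/ exists2 sp : spec H, spec_ok C sp /\ (forall w, ~ spec_lang C sp w) &
    num = spec_code n eH sp.
Proof.
move=> h; case: (classic Q) => [|/h e]; [by left|right].
exists (sp_empty rE H); last by rewrite sp_empty_code.
by split=> [|w]; [exact: sp_empty_ok|exact: sp_emptyE].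
Qed.

Lemma compile_lasso fl : exists c, forall P, prog_over C P -> exists P',
  [/\ prog_over C P', eval c (enc_prog P) (enc_prog P') &
    implements C (@aspec r1 rE fl P) (ARun (state0 P))
      (acount 1 (mset0 P) (fun=> 0) (fun=> 0) (fun=> 0) (fun=> 0))
      (@astate_code _ _) (ncoloured (nhandlers (enc_prog P))) P'].
Proof.
apply: (compile C_image (enc := enc_prog) (dom := prog_over C)
  (S := fun P => astate (states P) (handlers P))
  (H := fun P => coloured (handlers P))
  (eS := fun P => @astate_code _ _) (eH := fun P => @coloured_code _)
  (Sp := fun P => @aspec r1 rE fl P) (s0 := fun P => ARun (state0 P))
  (m0 := fun P => acount 1 (mset0 P) (fun=> 0) (fun=> 0) (fun=> 0) (fun=> 0))
  (N := fun x => (npair 7 (npair (nstates x) (npair (nstates x) (nhandlers x)))).+1)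
  (M := fun x => ncoloured (nhandlers x)) (i0 := fun x => npair 0 (nstate0 x))
  (num := fun v => acode r1 rE fl (nfst v) (nfst (nsnd v)) (nfst (nsnd (nsnd v)))
     (nsnd (nsnd (nsnd v)))) (mu := amu)).
- by rewrite /nstates /nhandlers; computable_tac.
- by rewrite /nhandlers; computable_prog.
- by rewrite /nstate0; computable_tac.
- by rewrite /acode /avalid /nstates /nhandlers; cbv zeta; computable_prog.
- by rewrite /amu /nhandlers /nmset0; computable_prog.
move=> P hP; rewrite !nstatesE !nhandlersE; split.
  split; [exact: astate_code_inj|exact: coloured_code_inj
         |exact: astate_code_bound|exact: coloured_code_bound].
split=> [s h s'|s h s'|i j k|].
- exact: aspec_ok.
- by rewrite !npairK acodeE.
- rewrite !npairK; apply: empty_case => hn; rewrite /acode nstatesE nhandlersE.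
  case: ifP => // /andP [/andP [/avalidP [s es] /coloured_validP [h eh]]].
  move=> /avalidP [s' es'].
  by case: hn; exists s, h, s'.
split=> [|h|j]; first by rewrite nstate0E.
  rewrite /amu nhandlersE coloured_code_valid.
  by case: h => [|x|x|x|x|x]; rewrite /= !npairK //= nmset0E.
rewrite /amu nhandlersE; case: ifP => // /coloured_validP [h ->] _.
by exists h.
Qed.

Lemma decidable_lasso fl : config_reachability_decidable C ->
  rec_decidable enc_prog (prog_over C)
    (fun P => lasso (prog_lang C (P := P)) fl (state0 P) (mset0 P)).
Proof.
apply: rec_decidable_reduce; have [c hc] := compile_lasso fl.
(* The code of the target: state [ADone] with a table of zeros. *)
have [d hd] : computable (fun x => npair (npair 7 0)
    (enc_seq (fun=> 0) (iota 0 (ncoloured (nhandlers x))))).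
  apply: computable_npair; first by computable_tac.
  apply: (computable_table (g := fun _ _ => 0)); last by computable_tac.
  by rewrite /nhandlers; computable_prog.
exists (CPair c d) => P hP; have [P' [hP' hcP imp]] := hc P hP.
have [t [et ht]] := implements_reachable0 ADone imp.
exists (existT _ P' t); split=> //=.
  exists (enc_prog P'), (enc_config t); split=> //.
  by rewrite et; apply: hd.
rewrite ht; split; first exact: alasso_reach.
exact: (areach_lasso hr1 hrE).
Qed.

Lemma compile_reach : exists c, forall x : {P : async_prog & config P},
  prog_over C (projT1 x) -> exists P',
  [/\ prog_over C P',
    eval c (npair (enc_prog (projT1 x)) (enc_config (projT2 x))) (enc_prog P') &
    implements C (@bspec r1 rE _ (projT2 x).1) (BRun (state0 (projT1 x)))
      (bcount 2 (mset0 (projT1 x)) (projT2 x).2) (@bstate_code _ _)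
      (ncoloured (nhandlers (nfst (npair (enc_prog (projT1 x)) (enc_config (projT2 x))))))
      P'].
Proof.
apply: (compile C_image (X := {P : async_prog & config P})
  (enc := fun x => npair (enc_prog (projT1 x)) (enc_config (projT2 x)))
  (dom := fun x => prog_over C (projT1 x))
  (S := fun x => bstate (states (projT1 x)) (handlers (projT1 x)))
  (H := fun x => coloured (handlers (projT1 x)))
  (eS := fun x => @bstate_code _ _) (eH := fun x => @coloured_code _)
  (Sp := fun x => @bspec r1 rE _ (projT2 x).1)
  (s0 := fun x => BRun (state0 (projT1 x)))
  (m0 := fun x => bcount 2 (mset0 (projT1 x)) (projT2 x).2)
  (N := fun x => (npair 2 (npair (nstates (nfst x)) (nhandlers (nfst x)))).+1)
  (M := fun x => ncoloured (nhandlers (nfst x)))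
  (i0 := fun x => npair 0 (nstate0 (nfst x)))
  (num := fun v => bcode r1 rE (nfst (nfst v)) (nfst (nsnd (nfst v)))
     (nfst (nsnd v)) (nfst (nsnd (nsnd v))) (nsnd (nsnd (nsnd v))))
  (mu := fun x j => bmu (nfst x) (nsnd x) j)).
- by rewrite /nstates /nhandlers; computable_tac.
- by rewrite /nhandlers; computable_prog.
- by rewrite /nstate0; computable_tac.
- by rewrite /bcode /bvalid /nstates /nhandlers; cbv zeta; computable_prog.
- by rewrite /bmu /nhandlers /nmset0; computable_prog.
move=> [P [dt mt]] /= hP; rewrite !npairK !nstatesE !nhandlersE; split.
  split; [exact: bstate_code_inj|exact: coloured_code_inj
         |exact: bstate_code_bound|exact: coloured_code_bound].
split=> [s h s'|s h s'|i j k|].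
- exact: bspec_ok.
- by rewrite !npairK bcodeE.
- rewrite !npairK; apply: empty_case => hn; rewrite /bcode nstatesE nhandlersE.
  case: ifP => // /andP [/andP [/bvalidP [s es] /coloured_validP [h eh]]].
  move=> /bvalidP [s' es'].
  by case: hn; exists s, h, s'.
split=> [|h|j]; first by rewrite nstate0E.
  rewrite /bmu nhandlersE coloured_code_valid.
  case: h => [|x|x|x|x|x]; rewrite /= !npairK //= ?nmset0E //.
  exact: dnth_enc_fun.
rewrite /bmu nhandlersE; case: ifP => // /coloured_validP [h ->] _.
by exists h.
Qed.

Lemma decidable_reach fl :
  rec_decidable enc_prog (prog_over C)
    (fun P => lasso (prog_lang C (P := P)) fl (state0 P) (mset0 P)) ->
  config_reachability_decidable C.
Proof.
apply: rec_decidable_reduce; have [c hc] := compile_reach.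
exists c => x hx; have [P' [hP' hcP imp]] := hc x hx.
exists P'; split=> //; rewrite (implements_lasso fl imp) reachableE.
split; first exact: reach_lasso.
(* [lasso_reach] is about lassos with nothing set aside; a starving lasso is first unfolded into a
   fair run, which yields such a lasso. *)
move=> hl; apply: (lasso_reach hr1 hrE).
apply/(implements_lasso false imp)/fair_runE.
have [run [s [h1 h2 _]]] := lasso_run ((implements_lasso fl imp).2 hl).
by exists run, s.
Qed.

Lemma compile_balanced : exists c, forall r, is_rep C 2 r -> exists P',
  [/\ prog_over C P', eval c r (enc_prog P') &
    implements C (zspec r1 rE r) ZStart zcount zstate_code (ncoloured 2) P'].
Proof.
apply: (compile C_image (enc := id) (dom := is_rep C 2) (S := fun=> zstate)
  (H := fun=> coloured 2) (eS := fun=> zstate_code) (eH := fun=> @coloured_code 2)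
  (Sp := fun r => zspec r1 rE r) (s0 := fun=> ZStart) (m0 := fun=> zcount)
  (N := fun=> 3) (M := fun=> ncoloured 2) (i0 := fun=> 0)
  (num := fun v => zcode r1 rE (nfst v) (nfst (nsnd v)) (nfst (nsnd (nsnd v)))
     (nsnd (nsnd (nsnd v)))) (mu := fun _ j => nat_of_bool (j == npair 0 0))).
- exact: computable_const.
- exact: computable_const.
- exact: computable_const.
- by rewrite /zcode; cbv zeta; computable_prog.
- by apply: computable_eq; computable_tac.
move=> r hr; split.
  split; [exact: zstate_code_inj|exact: coloured_code_inj
         |by case|exact: coloured_code_bound].
split=> [s h s'|s h s'|i j k|].
- exact: zspec_ok.
- by rewrite !npairK zcodeE.
- rewrite !npairK; apply: empty_case => hn; rewrite /zcode.
  case: ifP => // /andP [/andP [/zstate_codeP [s es] /coloured_validP [h eh]]].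
  move=> /zstate_codeP [s' es'].
  by case: hn; exists s, h, s'.
split=> [//|h|j].
  by case: h => [|x|x|x|x|x]; rewrite /= npair_eq.
by case: eqP => // -> _; exists Z.
Qed.

Lemma decidable_balanced : config_reachability_decidable C -> Z_intersection_decidable C.
Proof.
apply: rec_decidable_reduce; have [c hc] := compile_balanced.
have [d hd] := computable_const (npair 1 (enc_seq (fun=> 0) (iota 0 (ncoloured 2)))).
exists (CPair c d) => r hr; have [P' [hP' hcP imp]] := hc r hr.
have [t [et ht]] := implements_reachable0 ZTest imp.
exists (existT _ P' t); split=> //=.
  exists (enc_prog P'), (enc_config t); split=> //.
  by rewrite et; apply: hd.
by rewrite ht; apply: iff_sym; apply: zreachE.
Qed.

End NonTrivial.

(** * Classes all of whose languages are empty *)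

Lemma enc_config_inj P : injective (@enc_config P).
Proof.
move=> [d m] [d' m'] /npair_inj [/val_inj /= -> e]; congr pair.
apply/ffunP => x; have := congr1 (fun t => dnth t x) e.
by rewrite !dnth_enc_fun.
Qed.

Section Trivial.
Variable C : lang_class.
Hypothesis C_empty : forall k r (w : seq 'I_k), is_rep C k r -> ~ lang C r w.

Lemma no_step P c s c' : prog_over C P -> ~ @step C P c s c'.
Proof. by move=> hP [m [w [_ hw _]]]; apply: C_empty (hP _ _ _) hw. Qed.

(** No step is possible, so it suffices to compare the code of the configuration with that of the
    initial one. *)
Lemma trivial_reach : config_reachability_decidable C.
Proof.
have [c hc] : computable_bool (fun v =>
    nsnd v == npair (nstate0 (nfst v)) (nsnd (nsnd (nsnd (nsnd (nfst v)))))).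
  by rewrite /nstate0; apply: computable_eq; computable_tac.
exists c => -[P x] /= hP; exists (x == config0 P).
  have := hc (npair (enc_prog P) (enc_config x)); rewrite !npairK nstate0E.
  rewrite -[npair (state0 P) _]/(enc_config (config0 P)).
  by rewrite (inj_eq (@enc_config_inj P)).
split=> [/eqP ->|]; first by left; exists [::] => //; rewrite mem_head.
move=> [[[|[s y] r] hr hx]|[run [s [[_ hs] _]]]].
- by move: hx; rewrite mem_seq1.
- by case: hr => /(no_step hP).
- by case: (no_step hP (hs 0)).
Qed.

Lemma trivial_fair_termination : fair_termination_decidable C.
Proof.
apply: (@rec_decidable_const _ _ _ _ true) => P hP; split=> // _.
by move=> [c [s [[_ hs] _]]]; apply: no_step hP (hs 0).
Qed.

Lemma trivial_fair_starvation : fair_starvation_decidable C.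
Proof.
apply: (@rec_decidable_const _ _ _ _ false) => P hP; split=> //.
by move=> [c [s [[_ hs] _ _]]]; case: (no_step hP (hs 0)).
Qed.

Lemma trivial_Z : Z_intersection_decidable C.
Proof.
apply: (@rec_decidable_const _ _ _ _ false) => r hr; split=> //.
by move=> [w /(C_empty hr)].
Qed.

End Trivial.

(** * The problems in terms of lassos, and the equivalences *)

Lemma fair_terminationE C : fair_termination_decidable C <->
  rec_decidable enc_prog (prog_over C)
    (fun P => lasso (prog_lang C (P := P)) false (state0 P) (mset0 P)).
Proof.
split=> [h|].
  apply: rec_decidable_iff (rec_decidable_notnot h) => P _; exact: fair_runE.
move/rec_decidable_not; apply: rec_decidable_iff => P _.
by rewrite fair_runE.
Qed.

Lemma fair_starvationE C : fair_starvation_decidable C <->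
  rec_decidable enc_prog (prog_over C)
    (fun P => lasso (prog_lang C (P := P)) true (state0 P) (mset0 P)).
Proof.
by split; apply: rec_decidable_iff => P _; rewrite starving_runE.
Qed.

Theorem theorem4p4 (C : lang_class) (C_full_trio : full_trio C) :
  (config_reachability_decidable C <-> fair_termination_decidable C) /\
  (fair_termination_decidable C <-> fair_starvation_decidable C) /\
  (config_reachability_decidable C \/ fair_termination_decidable C \/
     fair_starvation_decidable C ->
   Z_intersection_decidable C).
Proof.
case: (classic (exists k r (w : seq 'I_k), is_rep C k r /\ lang C r w)); last first.
  move=> hn; have C_empty k r (w : seq 'I_k) : is_rep C k r -> ~ lang C r w.
    by move=> hr hw; apply: hn; exists k, r, w.
  have := trivial_reach C_empty; have := trivial_fair_termination C_empty.
  by have := trivial_fair_starvation C_empty; have := trivial_Z C_empty; tauto.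
move=> /(base_languages C_full_trio) [r1 [rE [ok1 okE hr1 hrE]]].
have [_ C_image _] := C_full_trio.
(* Reachability decides both kinds of lasso, and either kind decides reachability. *)
have lasso_dec fl := decidable_lasso C_image ok1 okE hr1 hrE fl.
have reach_dec fl := decidable_reach C_image ok1 okE hr1 hrE (fl := fl).
have := decidable_balanced C_image ok1 okE hr1 hrE.
have := lasso_dec true; have := lasso_dec false.
have := reach_dec true; have := reach_dec false.
by rewrite fair_terminationE fair_starvationE; tauto.
Qed.
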